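(* Given an integer $m\ge0$, the function $${}_1F_2\left[\begin{array}{c}1/2+m\\ b,\,c\end{array}\Big|-\frac{z^2}{4}\right]\qquad(z\in\mathbb{C})$$ belongs to $\mathcal{LP}$ for all $(b,c)\in\mathbb{R}_+^2$ lying on the line segments $b+c=k$, $k=1,2,\dots,2m+2$.
   Context: ${}_1F_2\left[\begin{array}{c}a\\ b,\,c\end{array}\Big|\,w\right]=\sum_{k=0}^\infty\frac{(a)_k}{k!\,(b)_k(c)_k}w^k$, where $(x)_k$ is the Pochhammer symbol. $\mathbb{R}_+=(0,\infty)$. The Laguerre–Pólya class $\mathcal{LP}$ is the class of all real entire functions $g$ having only real zeros, if any, which are representable in the form $g(z)=Az^\ell e^{-\alpha z^2+\beta z}\prod_{m=1}^\omega\left(1-\frac{z}{\sigma_m}\right)e^{z/\sigma_m}$, $0\le\omega\le\infty$, where $A,\alpha,\beta$ are real with $\alpha\ge0$, $\ell$ is a nonnegative integer and $(\sigma_m)$ is a sequence of non-zero reals with $\sum_{m=1}^\omega 1/\sigma_m^2<\infty$. *)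

(* Defs.v *)
From HB Require Import structures.
From mathcomp Require Import all_boot all_order all_algebra.
From mathcomp Require Import all_classical all_reals all_analysis.
From mathcomp Require Import complex.

Set Implicit Arguments.
Unset Strict Implicit.
Unset Printing Implicit Defensive.

Import Order.TTheory GRing.Theory Num.Theory numFieldNormedType.Exports.

Local Open Scope classical_set_scope.
Local Open Scope ring_scope.
Local Open Scope complex_scope.

Definition pochhammer (F : fieldType) (x : F) (k : nat) : F :=
  \prod_(0 <= i < k) (x + i%:R).

Definition hyp1F2_term (F : fieldType) (a b c w : F) (k : nat) : F :=
  pochhammer a k / (k`!%:R * pochhammer b k * pochhammer c k) * w ^+ k.

Section ComplexFunctions.
Variable R : realType.

(* [R[i]^o] is [R[i]] seen as a normed space over itself: this is what gives it
   the usual topology, and it makes [derivable _ z 1] complex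
   differentiability at [z]. *)

Definition hyp1F2 (a b c w : R[i]) : R[i] :=
  limn (series (hyp1F2_term a b c w) : nat -> R[i]^o).

Definition cexp (z : R[i]) : R[i] :=
  (expR (complex.Re z))%:C * (cos (complex.Im z) +i* sin (complex.Im z)).

Definition entire (g : R[i] -> R[i]) : Prop :=
  forall z : R[i], derivable (g : R[i]^o -> R[i]^o) z 1.

Definition real_entire (g : R[i] -> R[i]) : Prop :=
  entire g /\ forall x : R, complex.Im (g x%:C) = 0.

(* The length [omega] of the sequence [sigma] is [Some n] when it is finite and
   [None] when it is infinite. *)
Definition below (omega : option nat) (j : nat) : bool :=
  if omega is Some n then (j < n)%N else true.

Definition lp_factor (s : R) (z : R[i]) : R[i] :=
  (1 - z / s%:C) * cexp (z / s%:C).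

Definition lp_product (omega : option nat) (sigma : nat -> R) (z : R[i])
    (n : nat) : R[i] :=
  \prod_(0 <= j < n | below omega j) lp_factor (sigma j) z.

Definition lp_representable (g : R[i] -> R[i]) : Prop :=
  exists (A alpha beta : R) (l : nat) (omega : option nat) (sigma : nat -> R),
    [/\ 0 <= alpha,
        forall j, below omega j -> sigma j != 0,
        (\sum_(0 <= j <oo | below omega j) (sigma j ^- 2)%:E < +oo)%E
      & forall z : R[i], exists2 p : R[i],
          (lp_product omega sigma z : nat -> R[i]^o) @ \oo --> (p : R[i]^o)
        & g z = A%:C * z ^+ l * cexp (- alpha%:C * z ^+ 2 + beta%:C * z) * p].

Definition laguerre_polya (g : R[i] -> R[i]) : Prop :=
  [/\ real_entire g,
      forall z : R[i], g z = 0 -> complex.Im z = 0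
    & lp_representable g].

End ComplexFunctions.

(* Main.v *)
(** The function is a power series [sum_k a_k x^k] in [x = z^2 / 4].  For
    [mu = (b - c) / 2] not an integer, [1F2(1/2; 1 + mu, 1 - mu; -x)] is a product
    of Bessel functions of orders [mu] and [- mu], hence a limit of products of
    rescaled Laguerre polynomials [L_N^(mu) L_N^(- mu)].  If [n < mu < n + 1], all
    but [n] of the roots of such a product are positive (Hurwitz's theorem, here by
    counting sign changes), and the signs of its first coefficients make each of the
    first [n] derivatives gain a positive root next to [0], so that the [m]-th
    derivative, [m >= n], has positive roots only.  The [m]-th derivative of
    [1F2(1/2; 1 + mu, 1 - mu)] is a multiple of
    [1F2(1/2 + m; m + 1 + mu, m + 1 - mu)], which gives the case [b + c = 2 m + 2].
    Integer [mu] follow by continuity, and smaller values of [b + c] by the operators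
    [x d/dx + b], which turn [b + 1] into [b] and preserve positive roots.

    Finally, if polynomials [prod_j (1 - rho_(N,j) x)] with [rho_(N,j) >= 0] converge
    coefficientwise, then along an ultrafilter [rho_(N,j)] tends to some [rho_j], and
    the limit is [exp (- gamma x) prod_j (1 - rho_j x)] with [gamma >= 0] and
    [sum_j rho_j] finite: a Laguerre-Polya product in [z] with [alpha = gamma / 4] and
    roots [+- 2 / sqrt rho_j]. *)
Require Import Defs.
From mathcomp Require Import all_boot all_order all_algebra.
From mathcomp Require Import all_classical all_reals all_analysis.
From mathcomp Require Import complex.
From mathcomp Require Import ring lra zify.
Import Order.TTheory GRing.Theory Num.Theory numFieldNormedType.Exports.
Local Open Scope ring_scope.
Local Open Scope complex_scope.
Set Implicit Arguments.
Unset Strict Implicit.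
Unset Printing Implicit Defensive.

(** * Sign alternation of real polynomials on the positive half-line *)

Section Alternation.
Variable R : realType.
Implicit Types (q : {poly R}) (n : nat) (e x y : R).

(** A chain of [n + 1] positive points with head [x], the largest, along which the sign of [q]
    changes [n] times; only the sign of [e] matters. Counting sign changes instead of roots avoids
    multiplicities, and the strict inequalities survive small perturbations. *)
Fixpoint alternates q n e x : Prop :=
  [/\ 0 < x, 0 < e * q.[x]
    & if n is n'.+1 then exists2 y, y < x & alternates q n' (- e) y else True].

Lemma alternatesS q n e x : alternates q n.+1 e x <->
  [/\ 0 < x, 0 < e * q.[x] & exists2 y, y < x & alternates q n (- e) y].
Proof. by []. Qed.

Lemma alternates_sign q n e x : alternates q n e x -> 0 < x /\ 0 < e * q.[x].
Proof. by case: n => [|n] /= []. Qed.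

Lemma alternates_scale q n (c e x : R) : 0 < c ->
  alternates q n e x -> alternates q n (c * e) x.
Proof.
move=> c0; elim: n e x => [|n IH] e x /= [x0 ex h]; split => //.
- by rewrite -mulrA mulr_gt0.
- by rewrite -mulrA mulr_gt0.
- by case: h => y yx h; exists y => //; rewrite -mulrN; exact: IH.
Qed.

Lemma alternatesZ q n (c e x : R) :
  alternates q n (e * c) x -> alternates (c *: q) n e x.
Proof.
elim: n e x => [|n IH] e x /= [x0 ex h]; split => //; rewrite ?hornerZ ?mulrA//.
by case: h => y yx h; exists y => //; apply: IH; rewrite mulNr.
Qed.

Lemma alternates_comp_scale q n (c e x : R) : 0 < c ->
  alternates q n e x -> alternates (q \Po (c *: 'X)) n e (x / c).
Proof.
move=> c0; have c1 : c != 0 by rewrite gt_eqF.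
have E y : (q \Po (c *: 'X)).[y / c] = q.[y].
  by rewrite horner_comp hornerZ hornerX mulrC divfK.
elim: n e x => [|n IH] e x /= [x0 ex h]; split; rewrite ?E ?divr_gt0//.
case: h => y yx /IH h; exists (y / c) => //.
by rewrite ltr_pM2r // invr_gt0.
Qed.

(** This is [t ^ (1 - kappa) * exp (- s t)] times the derivative of [t ^ kappa * exp (s t) * q t],
    so Rolle's argument applies to it on the positive axis. The value [s = -1] generates Laguerre
    polynomials, [s = 0] lowers a hypergeometric parameter, and [kappa = s = 0] gives [t] times the
    derivative. *)
Definition euler_op (kappa s : R) q : {poly R} :=
  'X * q^`() + (kappa%:P + s *: 'X) * q.

(* Mean value theorem for the function [q t * t ^ kappa * exp (s t)]. *)
Lemma weighted_rolle (kappa s : R) q e x y : 0 < y -> y < x ->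
  0 < e * q.[x] -> 0 < - e * q.[y] ->
  exists2 xi, y < xi < x & 0 < e * (euler_op kappa s q).[xi].
Proof.
move=> y0 yx ex ey.
pose h := fun t : R => s * t + kappa * ln t.
pose g := fun t : R => q.[t] * expR (h t).
pose dg := fun t : R => (q^`().[t] + (s + kappa / t) * q.[t]) * expR (h t).
have dgE (t : R) : 0 < t -> is_derive t (1 : R) g (dg t).
  move=> t0.
  have d1 := is_derive1_ln t0.
  have d2 : is_derive t (1 : R) h (s + kappa / t).
    have -> : h = (s \*: (@id R) + kappa \*: (@ln R)).
      by apply/funext => u.
    apply: (is_derive_eq (is_deriveD (is_deriveZ s (is_derive_id t (1 : R)))
      (is_deriveZ kappa d1))).
    by rewrite /GRing.scale /= mulr1.
  have d3 : is_derive t (1 : R) (expR \o h) (expR (h t) * (s + kappa / t)).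
    exact: is_derive1_comp.
  have d4 := is_derive_poly q t.
  have -> : g = horner q * (expR \o h) by apply/funext => u.
  apply: (is_derive_eq (is_deriveM d4 d3)); rewrite /GRing.scale /= /dg; ring.
have [||xi] := @MVT R g dg y x yx.
  by move=> t; rewrite in_itv /= => /andP[yt _]; apply: dgE; apply: lt_trans yt.
  apply/continuous_in_subspaceT => t; rewrite inE /= in_itv /= => /andP[yt _].
  have t0 : 0 < t by apply: lt_le_trans yt.
  by apply: differentiable_continuous; apply/derivable1_diffP;
     have [] := dgE _ t0.
rewrite in_itv /= => /andP[yxi xix] E; exists xi; first by rewrite yxi.
have xi0 : 0 < xi by apply: lt_trans yxi.
have : 0 < e * (g x - g y).
  rewrite /g mulrBr subr_gt0; apply: (@lt_trans _ _ 0).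
    by rewrite mulrA pmulr_llt0 ?expR_gt0// -oppr_gt0 -mulNr.
  by rewrite mulrA mulr_gt0 ?expR_gt0.
rewrite E /dg mulrA pmulr_lgt0 ?subr_gt0// mulrA pmulr_lgt0 ?expR_gt0// => H.
have -> : e * (euler_op kappa s q).[xi] =
   xi * (e * (q^`().[xi] + (s + kappa / xi) * q.[xi])).
  rewrite /euler_op !hornerE /=; field; exact: lt0r_neq0.
by rewrite mulr_gt0.
Qed.

(** Each gap of the chain yields one point by [weighted_rolle]; consecutive gaps are ordered, hence
    so are the points. One sign change is lost. *)
Lemma alternates_euler_op (kappa s : R) q n e x : alternates q n.+1 e x ->
  exists2 xi, xi < x & alternates (euler_op kappa s q) n e xi.
Proof.
elim: n e x => [|n IH] e x /alternatesS[x0 ex [y yx h]].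
  have [y0 ey] := alternates_sign h.
  have [xi /andP[yxi xix] H] := weighted_rolle kappa s y0 yx ex ey.
  by exists xi => //=; split => //; apply: lt_trans yxi.
have [y0 ey] := alternates_sign h.
have [xi /andP[yxi xix] H] := weighted_rolle kappa s y0 yx ex ey.
exists xi => //=; split => //; first exact: lt_trans yxi.
have [xi' xi'y h'] := IH _ _ h.
by exists xi' => //; apply: lt_trans yxi.
Qed.

Lemma alternates_divX q n e x : alternates ('X * q) n e x -> alternates q n e x.
Proof.
elim: n e x => [|n IH] e x /= [x0 ex h]; split => //.
- by move: ex; rewrite hornerM hornerX mulrCA pmulr_rgt0.
- by move: ex; rewrite hornerM hornerX mulrCA pmulr_rgt0.
- by case: h => y yx /IH h; exists y.
Qed.

Lemma alternates_deriv q n e x : alternates q n.+1 e x ->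
  exists2 xi, xi < x & alternates q^`() n e xi.
Proof.
move=> /(alternates_euler_op 0 0)[xi xix h]; exists xi => //.
by apply: alternates_divX; move: h; rewrite /euler_op scale0r addr0 mul0r addr0.
Qed.

Lemma horner_near q (x d : R) e : 0 < d -> 0 < e * q.[x] ->
  exists2 r, 0 < r <= d & forall y, `|y - x| <= r -> 0 < e * q.[y].
Proof.
move=> d0 ex.
have : ((fun y : R => e * q.[y]) @ x --> e * q.[x])%classic.
  by apply: cvgMl_tmp; exact: continuous_horner.
move=> /cvgrPdist_lt /(_ _ ex).
rewrite -filter_from_ballE => -[r /= r0 H].
exists (Num.min (r / 2) d); first by rewrite lt_min d0 divr_gt0//= ge_min lexx orbT.
move=> y yx; have := H y; rewrite /ball /= => /(_ _).
have : `|x - y| < r.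
  by rewrite distrC (le_lt_trans yx)// gt_min; apply/orP; left; lra.
move=> h /(_ h); rewrite ltr_distlC; lra.
Qed.

(** The last point of the chain carries the sign of [(-1) ^+ n * e]. The opposite sign at 0 persists
    at a small positive point, which prolongs the chain downwards. *)
Lemma alternates_lower q n e x : alternates q n e x ->
  0 < (-1) ^+ n.+1 * e * q.[0] -> alternates q n.+1 e x.
Proof.
elim: n e x => [|n IH] e x.
  move=> [x0 ex _]; rewrite expr1 mulN1r => h0; split => //.
  have [r /andP[r0 rx] H] := @horner_near q 0 (x / 2) _ (divr_gt0 x0 (ltr0Sn R 1)) h0.
  exists r; first lra.
  by split => //; apply: H; rewrite subr0 gtr0_norm.
move=> /alternatesS[x0 ex [y yx h]] h0; split => //.
by exists y => //; apply: IH => //; move: h0; rewrite exprS mulN1r mulNr -mulrN.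
Qed.

(** The polynomial is negative at the head and positive near infinity, which gives one more sign
    change above the chain. *)
Lemma alternates_upper q n x : 0 < lead_coef q -> alternates q n (-1) x ->
  exists y, alternates q n.+1 1 y.
Proof.
move=> lq h; have [x0 hx] := alternates_sign h.
have sq : (1 < size q)%N.
  rewrite ltnNge; apply/negP => /size1_polyC E; move: hx lq.
  by rewrite E hornerC lead_coefC; lra.
have [] := polyrcf.poly_pinfty_gt_lc lq => y0 hy.
exists (Num.max y0 (x + 1)); split.
- by rewrite lt_max; apply/orP; right; lra.
- by rewrite mul1r; apply: lt_le_trans lq _; apply: hy; rewrite le_max lexx.
- by exists x => //; rewrite lt_max; apply/orP; right; lra.
Qed.

Lemma alternates_roots q n e x : alternates q n e x ->
  exists rs : seq R, [/\ size rs = n, uniq rs, all (root q) rs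
                       & all (fun r => 0 < r < x) rs].
Proof.
elim: n e x => [|n IH] e x; first by move=> _; exists [::].
move=> /alternatesS[x0 ex [y yx h]]; have [y0 ey] := alternates_sign h.
have [rs [s1 s2 s3 s4]] := IH _ _ h.
have [|r] := @polyrcf.poly_ivtoo R q y x (ltW yx).
  rewrite mulNr oppr_gt0 in ey.
  have [e0|e0|e0] := ltgtP e 0.
  - by rewrite nmulr_rgt0// in ex; rewrite nmulr_rlt0// in ey; rewrite pmulr_rlt0.
  - by rewrite pmulr_rgt0// in ex; rewrite pmulr_rlt0// in ey; rewrite nmulr_rlt0.
  - by rewrite e0 mul0r ltxx in ex.
rewrite in_itv /= => /andP[yr rx] rr.
exists (r :: rs); split => /=.
- by rewrite s1.
- rewrite s2 andbT; apply/negP => /(allP s4) /andP[_]; lra.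
- by rewrite rr.
- rewrite (lt_trans y0 yr) rx /=; apply/allP => t /(allP s4) /andP[-> ty] /=.
  exact: lt_trans yx.
Qed.

Lemma alternates_size q n e x : alternates q n e x -> (n < size q)%N.
Proof.
move=> h; have [rs [<- s2 s3 _]] := alternates_roots h.
apply: max_poly_roots => //; apply/eqP => q0; have [_] := alternates_sign h.
by rewrite q0 horner0 mulr0 ltxx.
Qed.

(* A full set of positive roots leaves none for the closed negative axis. *)
Lemma alternates_full_at0 q n e x : alternates q n e x -> size q = n.+1 ->
  0 < (-1) ^+ n * e * q.[0].
Proof.
move=> h sq.
have [|h0|h0] := ltgtP 0 ((-1) ^+ n * e * q.[0]) => //.
  have /alternates_size : alternates q n.+1 e x.
    by apply: alternates_lower => //; rewrite exprS mulN1r !mulNr oppr_gt0.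
  by rewrite sq ltnn.
have e0 : e != 0.
  by apply/eqP => e0; have [_] := alternates_sign h; rewrite e0 mul0r ltxx.
have q00 : root q 0.
  by move/eqP: h0; rewrite eq_sym mulf_eq0 mulf_eq0 signr_eq0 (negbTE e0).
have [rs [s1 s2 s3 s4]] := alternates_roots h.
have : (size (0%R :: rs) < size q)%N.
  apply: max_poly_roots; rewrite /= ?q00// ?s2 ?andbT.
    by rewrite -size_poly_eq0 sq.
  by apply/negP => /(allP s4); rewrite ltxx.
by rewrite /= s1 sq ltnn.
Qed.

Lemma alternates_mulXsubC_lt q n e x (r : R) : x < r ->
  alternates q n e x -> alternates (('X - r%:P) * q) n (- e) x.
Proof.
elim: n e x => [|n IH] e x xr /= [x0 ex h]; split => //.
- by rewrite hornerM hornerXsubC mulrCA nmulr_rgt0 ?subr_lt0// mulNr oppr_lt0.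
- by rewrite hornerM hornerXsubC mulrCA nmulr_rgt0 ?subr_lt0// mulNr oppr_lt0.
- by case: h => y yx /IH h; exists y => //; apply: h; apply: lt_trans xr.
Qed.

Lemma mulXsubC_sign_gt q e r x : r < x ->
  (0 < e * (('X - r%:P) * q).[x]) = (0 < e * q.[x]).
Proof. by move=> rx; rewrite hornerM hornerXsubC mulrCA pmulr_rgt0 ?subr_gt0. Qed.

Lemma mulXsubC_sign_lt q e r x : x < r ->
  (0 < e * (('X - r%:P) * q).[x]) = (0 < - e * q.[x]).
Proof.
by move=> rx; rewrite hornerM hornerXsubC mulrCA nmulr_rgt0 ?subr_lt0// mulNr oppr_gt0.
Qed.

(** Below [r] the new factor reverses every sign of the chain. Near [r] the polynomial [q] keeps its
    sign while the factor changes its own, so on one side of [r] the product has the sign required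
    of a new head. *)
Lemma alternates_insert_lt q n e x (r u : R) : x < r -> r < u -> e != 0 ->
  alternates q n e x -> q.[r] != 0 ->
  exists2 y, y < u & alternates (('X - r%:P) * q) n.+1 e y.
Proof.
move=> xr ru e0 h qr; have [x0 _] := alternates_sign h.
have h' := alternates_mulXsubC_lt xr h.
have d0 : 0 < Num.min (r - x) (u - r) / 2.
  by rewrite divr_gt0// lt_min !subr_gt0 xr.
have dx : Num.min (r - x) (u - r) <= r - x by rewrite ge_min lexx.
have du : Num.min (r - x) (u - r) <= u - r by rewrite ge_min lexx orbT.
have [s|s|s] := ltgtP 0 (e * q.[r]).
- have [t /andP[t0 td] H] := horner_near d0 s.
  exists (r + t); first lra.
  split; first lra.
    rewrite mulXsubC_sign_gt; last lra.
    by apply: H; rewrite addrAC subrr add0r gtr0_norm.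
  exists x => //; lra.
- rewrite -oppr_gt0 -mulNr in s.
  have [t /andP[t0 td] H] := horner_near d0 s.
  exists (r - t); first lra.
  split; first lra.
    rewrite mulXsubC_sign_lt; last lra.
    by apply: H; rewrite addrAC subrr add0r normrN gtr0_norm.
  exists x => //; lra.
- by move/esym/eqP: s; rewrite mulf_eq0 (negbTE e0) (negbTE qr).
Qed.

Lemma alternates_head q n e x y : x < y -> 0 < e * q.[y] ->
  alternates q n e x -> alternates q n e y.
Proof.
move=> xy ey; case: n => [|n] /= [x0 ex h]; split => //; try exact: lt_trans xy.
by case: h => z zx h; exists z => //; apply: lt_trans xy.
Qed.

(** It remains to treat a head above [r]: a head equal to [r] is first pushed up a little. The bound
    [u] keeps the new head below the preceding point when the chain is part of a longer one. *)
Lemma alternates_insert_from_gt q n e x (r u : R) :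
  (forall z, r < z -> alternates q n e z ->
    alternates (('X - r%:P) * q) n.+1 e z) ->
  r < u -> x < u -> alternates q n e x -> q.[r] != 0 ->
  exists2 y, y < u & alternates (('X - r%:P) * q) n.+1 e y.
Proof.
move=> H ru xu h qr; have [x0 ex] := alternates_sign h.
have e0 : e != 0 by apply/eqP => e0; move: ex; rewrite e0 mul0r ltxx.
have [xr|rx|xr] := ltgtP x r.
- exact: alternates_insert_lt xr _ _ _ _.
- by exists x => //; exact: H.
- subst r; have ux : 0 < (u - x) / 2 by lra.
  have [t /andP[t0 tu] Ht] := horner_near ux ex.
  have ht : 0 < e * q.[x + t] by apply: Ht; rewrite addrAC subrr add0r gtr0_norm.
  exists (x + t); first lra.
  by apply: H; [lra|apply: alternates_head h => //; lra].
Qed.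

(** A new simple positive root adds one sign change. Points above [r] keep their sign, so the
    induction walks down the chain until [r] lies above the remaining head, or until a single point
    is left and the new point is placed next to [r]. *)
Lemma alternates_insert q n e x (r u : R) : 0 < r -> r < u -> x < u ->
  alternates q n e x -> q.[r] != 0 ->
  exists2 y, y < u & alternates (('X - r%:P) * q) n.+1 e y.
Proof.
move=> r0 + + + qr; elim: n e x u => [|n IH] e x u ru xu h;
  apply: alternates_insert_from_gt (ru) (xu) (h) (qr).
- move=> z rz [z0 ez _]; have e0 : e != 0.
    by apply/eqP => e0; move: ez; rewrite e0 mul0r ltxx.
  split; [by []|by rewrite mulXsubC_sign_gt|].
  have d0 : 0 < Num.min r (z - r) / 2 by rewrite divr_gt0// lt_min r0 subr_gt0.
  have dx : Num.min r (z - r) <= r by rewrite ge_min lexx.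
  have du : Num.min r (z - r) <= z - r by rewrite ge_min lexx orbT.
  have [s|s|s] := ltgtP 0 (e * q.[r]).
  + have [t /andP[t0 td] Ht] := horner_near d0 s.
    exists (r - t); first lra.
    split => //; first lra.
    rewrite mulXsubC_sign_lt ?opprK; last lra.
    by apply: Ht; rewrite addrAC subrr add0r normrN gtr0_norm.
  + rewrite -oppr_gt0 -mulNr in s.
    have [t /andP[t0 td] Ht] := horner_near d0 s.
    exists (r + t); first lra.
    split => //; first lra.
    rewrite mulXsubC_sign_gt; last lra.
    by apply: Ht; rewrite addrAC subrr add0r gtr0_norm.
  + by move/esym/eqP: s; rewrite mulf_eq0 (negbTE e0) (negbTE qr).
- move=> z rz /alternatesS[z0 ez [y yz h']]; apply/alternatesS.
  by split => //; [rewrite mulXsubC_sign_gt|exact: IH h'].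
Qed.

End Alternation.

(** * Pochhammer identities and the product of two Bessel series *)

Section PochhammerIdentities.
Variable F : numFieldType.
Implicit Types (x y : F) (k n : nat).

Lemma pochhammer0 x : pochhammer x 0 = 1.
Proof. by rewrite /pochhammer big_geq. Qed.

Lemma pochhammerSr x k : pochhammer x k.+1 = pochhammer x k * (x + k%:R).
Proof. by rewrite /pochhammer big_nat_recr. Qed.

Lemma pochhammerSl x k : pochhammer x k.+1 = x * pochhammer (x + 1) k.
Proof.
rewrite /pochhammer big_nat_recl//= addr0; congr (_ * _).
by apply: eq_bigr => i _; rewrite -[in LHS]addn1 natrD addrA addrAC.
Qed.

Lemma pochhammerD x m k :
  pochhammer x (m + k) = pochhammer x m * pochhammer (x + m%:R) k.
Proof.
elim: k => [|k IH]; first by rewrite addn0 pochhammer0 mulr1.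
by rewrite addnS !pochhammerSr IH natrD addrA mulrA.
Qed.

Lemma pochhammer_gt0 x k : 0 < x -> 0 < pochhammer x k.
Proof.
move=> x0; elim: k => [|k IH]; first by rewrite pochhammer0.
by rewrite pochhammerSr mulr_gt0// ltr_wpDr.
Qed.

(** Both sides equal the factorial of [2 k] divided by that of [k]. *)
Lemma pochhammer_half k :
  pochhammer (k.+1%:R : F) k = 4 ^+ k * pochhammer (1 / 2) k.
Proof.
elim: k => [|k IH]; first by rewrite !pochhammer0 mulr1.
have k0 : (k.+1%:R : F) != 0 by rewrite pnatr_eq0.
apply: (mulfI k0).
have -> : k.+1%:R * pochhammer (k.+2%:R : F) k.+1 = pochhammer (k.+1%:R : F) k.+2.
  by rewrite [RHS]pochhammerSl; congr (_ * pochhammer _ _); rewrite -[k.+2]addn1 natrD.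
by rewrite !pochhammerSr IH exprS; field.
Qed.

Definition falling x k := \prod_(0 <= i < k) (x - i%:R).

Lemma fallingSr x k : falling x k.+1 = falling x k * (x - k%:R).
Proof. by rewrite /falling big_nat_recr. Qed.

Lemma fallingSl x k : falling (x + 1) k.+1 = (x + 1) * falling x k.
Proof.
rewrite /falling big_nat_recl//= subr0; congr (_ * _).
by apply: eq_bigr => i _; rewrite -[in LHS]addn1 natrD; ring.
Qed.

Lemma pochhammer_falling x i d :
  pochhammer (1 + x) (i + d) = pochhammer (1 + x) i * falling (x + (i + d)%:R) d.
Proof.
elim: d => [|d IH]; first by rewrite addn0 /falling big_geq// mulr1.
rewrite addnS pochhammerSr IH -natr1 addrA fallingSl; ring.
Qed.

Lemma falling_nat k : falling (k%:R + k%:R) k = pochhammer (k.+1%:R : F) k.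
Proof.
have := pochhammer_falling k%:R 0 k.
by rewrite add0n pochhammer0 mul1r -natr1 addrC => ->; rewrite addrC.
Qed.

(** The Chu-Vandermonde identity: the new factor [x + y - k] splits as [(x - (k - i)) + (y - i)],
    and Pascal's rule recombines the two sums. *)
Lemma vandermonde x y k :
  falling (x + y) k =
  \sum_(i < k.+1) 'C(k, i)%:R * falling x (k - i) * falling y i.
Proof.
elim: k => [|k IH].
  by rewrite big_ord_recl big_ord0 bin0 /falling !big_geq// !mulr1 addr0.
have E : \sum_(i < k.+1) 'C(k, i)%:R * falling x (k - i) * falling y i * (x + y - k%:R)
  = \sum_(i < k.+1) 'C(k, i)%:R * falling x (k.+1 - i) * falling y i
  + \sum_(i < k.+1) 'C(k, i)%:R * falling x (k - i) * falling y i.+1.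
  rewrite -big_split /=; apply: eq_bigr => i _.
  have ik : (i <= k)%N by rewrite -ltnS.
  by rewrite subSn// !fallingSr natrB//; ring.
rewrite fallingSr IH mulr_suml E big_ord_recl [X in _ + X]big_ord_recr /=.
rewrite [RHS]big_ord_recl [X in _ = _ + X]big_ord_recr /=.
rewrite !bin0 !binn subnn /bump /= !add1n subnn -!addrA; congr (_ + _).
rewrite addrA; congr (_ + _); rewrite -big_split /=; apply: eq_bigr => i _.
by rewrite add1n binS natrD !mulrDl subSS addrC.
Qed.

(** The coefficient form of ${}_0F_1(1+x;t)\,{}_0F_1(1-x;t)={}_1F_2(1/2;1+x,1-x;4t)$. Once
    denominators are cleared, the left side is a Vandermonde sum for [2 k = (x + k) + (- x + k)]. *)
Lemma clausen_coef x k :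
  pochhammer (1 + x) k != 0 -> pochhammer (1 - x) k != 0 ->
  \sum_(i < k.+1) (i`!%:R * pochhammer (1 + x) i)^-1
                * ((k - i)`!%:R * pochhammer (1 - x) (k - i))^-1
  = 4 ^+ k * (pochhammer (1 / 2) k
              / (k`!%:R * pochhammer (1 + x) k * pochhammer (1 - x) k)).
Proof.
move=> hx hy; rewrite mulrA -pochhammer_half -falling_nat.
have -> : (k%:R + k%:R : F) = (x + k%:R) + (- x + k%:R) by ring.
rewrite vandermonde mulr_suml; apply: eq_bigr => i _.
have ik : (i <= k)%N by rewrite -ltnS.
have f0 n : (n`!%:R : F) != 0 by rewrite pnatr_eq0 -lt0n fact_gt0.
have := pochhammer_falling x i (k - i); rewrite subnKC// => e1.
have := pochhammer_falling (- x) (k - i) i; rewrite subnK// => e2.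
rewrite -(bin_fact ik) e1 e2 !natrM.
have b0 : ('C(k, i)%:R : F) != 0 by rewrite pnatr_eq0 -lt0n bin_gt0.
move: hx hy; rewrite {1}e1 {1}e2 !mulf_eq0 !negb_or => /andP[h1 h2] /andP[h3 h4].
by field; rewrite ?f0 ?b0 ?h1 ?h2 ?h3 ?h4.
Qed.

End PochhammerIdentities.

(** * Laguerre polynomials and their sign changes *)

Section Laguerre.
Variable R : realType.
Implicit Types (q : {poly R}) (alpha : R).

(* Monic Laguerre polynomials: [(-1)^N N! L_N^(alpha)]. *)
Fixpoint laguerre N alpha : {poly R} :=
  if N is N'.+1 then - euler_op (alpha + 1) (-1) (laguerre N' (alpha + 1)) else 1.

Lemma coef_euler_op (kappa s : R) q k : (euler_op kappa s q)`_k =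
  (k%:R + kappa) * q`_k + (if k is k'.+1 then s * q`_k' else 0).
Proof.
rewrite /euler_op mulrDl coefD coefXM coefD coefCM -scalerAl coefZ coefXM.
case: k => [|k] /=; first by rewrite !add0r mulr0 addr0.
by rewrite coef_deriv mulrDl mulr_natl addrA.
Qed.

(** The explicit coefficients, kept free of division because [pochhammer (1 + alpha) k] can vanish
    when [alpha] is a negative integer. The recursion reduces to Pascal's rule. *)
Lemma laguerre_coef N alpha k :
  (laguerre N alpha)`_k * pochhammer (1 + alpha) k =
  (-1) ^+ (N + k) * 'C(N, k)%:R * pochhammer (1 + alpha) N.
Proof.
elim: N alpha k => [|N IH] alpha k /=.
  rewrite coef1; case: k => [|k] /=; first by rewrite addn0 expr0 bin0 mul1r.
  by rewrite bin0n /= !mul0r mulr0 mul0r.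
have E n : pochhammer (1 + alpha) n.+1 = (1 + alpha) * pochhammer (1 + (alpha + 1)) n.
  by rewrite pochhammerSl addrA.
rewrite coefN coef_euler_op; case: k => [|k].
  rewrite pochhammer0 mulr1 addr0 add0r addn0 exprS bin0 mulr1 E.
  by have := IH (alpha + 1) 0; rewrite pochhammer0 mulr1 addn0 bin0 mulr1 => ->; ring.
have h1 := IH (alpha + 1) k; have h2 := IH (alpha + 1) k.+1.
rewrite pochhammerSr in h2.
rewrite !E binS natrD addSn addnS !exprS.
rewrite addnS exprS in h2.
transitivity (- (1 + alpha) * ((laguerre N (alpha + 1))`_k.+1 *
    (pochhammer (1 + (alpha + 1)) k * (1 + (alpha + 1) + k%:R)))
  + (1 + alpha) * ((laguerre N (alpha + 1))`_k * pochhammer (1 + (alpha + 1)) k)).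
  by rewrite -[in LHS]natr1; ring.
by rewrite h1 h2; ring.
Qed.

Lemma laguerre_coef_top N alpha k : (N <= k)%N -> (laguerre N alpha)`_k = (k == N)%:R.
Proof.
elim: N alpha k => [|N IH] alpha [|k] //= Nk; rewrite ?coef1//.
rewrite coefN coef_euler_op !IH//; last exact: ltnW.
by rewrite gtn_eqF// mulr0 add0r mulN1r opprK.
Qed.

Lemma size_laguerre N alpha : size (laguerre N alpha) = N.+1.
Proof.
apply/eqP; rewrite eqn_leq; apply/andP; split.
  apply/leq_sizeP => k Nk; rewrite laguerre_coef_top ?gtn_eqF//; exact: ltnW.
rewrite ltnNge; apply/negP => /leq_sizeP /(_ N (leqnn N)).
by rewrite laguerre_coef_top// eqxx; apply/eqP; rewrite oner_eq0.
Qed.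

Lemma lead_coef_laguerre N alpha : lead_coef (laguerre N alpha) = 1.
Proof. by rewrite lead_coefE size_laguerre laguerre_coef_top// eqxx. Qed.

(** Rolle's argument loses one sign change; the minus sign in the recursion makes the head negative,
    and the positive leading coefficient restores the change near infinity. *)
Lemma laguerre_alternates_step N alpha n x :
  alternates (laguerre N (alpha + 1)) n 1 x ->
  exists y, alternates (laguerre N.+1 alpha) n 1 y.
Proof.
have lp : 0 < lead_coef (laguerre N.+1 alpha) by rewrite lead_coef_laguerre.
case: n => [_|n h].
  have [y0 hy] := polyrcf.poly_pinfty_gt_lc lp.
  exists (Num.max y0 1); split => //; first by rewrite lt_max ltr01 orbT.
  by rewrite mul1r; apply: lt_le_trans lp _; apply: hy; rewrite le_max lexx.
have [xi _ hxi] := alternates_euler_op (alpha + 1) (-1) h.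
apply: (alternates_upper lp (x := xi)).
by rewrite /= -scaleN1r; apply: alternatesZ; rewrite mulrNN mulr1.
Qed.

(** In the classical range the constant coefficient has the sign of [(-1) ^+ N], so each step also
    gains a sign change next to 0. *)
Lemma laguerre_alternates_gtN1 N alpha : -1 < alpha ->
  exists x, alternates (laguerre N alpha) N 1 x.
Proof.
elim: N alpha => [|N IH] alpha a1.
  by exists 1; split => //=; rewrite hornerC mulr1.
have [|x hx] := IH (alpha + 1); first lra.
have [y hy] := laguerre_alternates_step hx.
exists y; apply: alternates_lower hy _.
have := laguerre_coef N.+1 alpha 0.
rewrite pochhammer0 mulr1 addn0 bin0 mulr1 -horner_coef0 => ->.
rewrite mulrA -expr2 sqrr_sign mul1r pochhammer_gt0//; lra.
Qed.

(** Raising the parameter [n] times reaches the classical range in degree [N]. Coming back, each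
    step raises the degree by one and keeps the number of sign changes, so at most [n] roots are
    missed. *)
Lemma laguerre_alternates n N alpha : -1 < alpha + n%:R ->
  exists x, alternates (laguerre (n + N) alpha) N 1 x.
Proof.
elim: n alpha => [|n IH] alpha a1.
  by apply: laguerre_alternates_gtN1; rewrite addr0 in a1.
have [|x hx] := IH (alpha + 1); last exact: laguerre_alternates_step hx.
by rewrite -natr1 in a1; lra.
Qed.

End Laguerre.

(** * Polynomials with positive roots only, and their coefficientwise limits *)

Section FullAlternation.
Variable R : realType.
Implicit Types (q : {poly R}) (a : nat -> R).

(* By [alternates_roots], all the roots of such a polynomial are positive and
   simple. *)
Definition fully_alternates q :=
  exists n e x, size q = n.+1 /\ alternates q n e x.

Lemma fully_alternatesZ (c : R) q : c != 0 ->
  fully_alternates q -> fully_alternates (c *: q).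
Proof.
move=> c0 [n [e [x [sq h]]]]; exists n, (e / c), x.
by rewrite size_scale//; split => //; apply: alternatesZ; rewrite divfK.
Qed.

(** The sign change lost by Rolle's argument is regained next to 0, where the value is only
    multiplied by [kappa > 0]. *)
Lemma fully_alternates_euler_op (kappa : R) q : 0 < kappa ->
  fully_alternates q -> fully_alternates (euler_op kappa 0 q).
Proof.
move=> k0 [n [e [x [sq h]]]]; have q0 := alternates_full_at0 h sq.
have E k : (euler_op kappa 0 q)`_k = (k%:R + kappa) * q`_k.
  by rewrite coef_euler_op; case: k => [|k]; rewrite ?mul0r addr0.
have E0 : (euler_op kappa 0 q).[0] = kappa * q.[0].
  by rewrite !horner_coef0 E add0r.
have h0 : 0 < (-1) ^+ n * e * (euler_op kappa 0 q).[0].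
  by rewrite E0 mulrCA mulr_gt0.
have [y hy] : exists y, alternates (euler_op kappa 0 q) n e y.
  case: n h h0 {q0 sq} => [|n] h h0.
    rewrite expr0 mul1r in h0.
    have [r /andP[r0 _] H] := horner_near ltr01 h0.
    by exists r; split => //; apply: H; rewrite subr0 gtr0_norm.
  have [xi _ hxi] := alternates_euler_op kappa 0 h.
  by exists xi; apply: alternates_lower hxi h0.
exists n, e, y; split => //; apply/eqP; rewrite eqn_leq.
rewrite (alternates_size hy) andbT; apply/leq_sizeP => j nj.
by rewrite E nth_default ?mulr0// sq.
Qed.

(** As for [fully_alternates_euler_op], except that the sign of the derivative at 0 must be
    supplied. *)
Lemma alternates_deriv_keep q n x : alternates q n 1 x ->
  0 < (-1) ^+ n * q^`().[0] -> exists y, alternates q^`() n 1 y.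
Proof.
case: n => [|n] h h0.
  rewrite expr0 in h0; have [r /andP[r0 _] H] := horner_near ltr01 h0.
  by exists r; split => //; apply: H; rewrite subr0 gtr0_norm.
have [xi _ hxi] := alternates_deriv h.
by exists xi; apply: alternates_lower hxi _; rewrite mulr1.
Qed.

Lemma alternates_derivn_keep q n x j : alternates q n 1 x ->
  (forall i, (0 < i <= j)%N -> 0 < (-1) ^+ n * q`_i) ->
  exists y, alternates q^`(j) n 1 y.
Proof.
move=> h; elim: j => [|j IH] hq; first by exists x; rewrite derivn0.
have [|y hy] := IH; first by move=> i /andP[i0 ij]; apply: hq; rewrite i0 ltnW.
rewrite derivnS; apply: alternates_deriv_keep hy _.
rewrite -derivnS horner_coef0 coef_derivn addn0 mulrnAr -mulr_natr.
by rewrite mulr_gt0 ?hq ?ltnSn// ltr0n ffact_gt0.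
Qed.

Lemma alternates_derivn q n j e x : alternates q (j + n) e x ->
  exists y, alternates q^`(j) n e y.
Proof.
elim: j n => [|j IH] n h; first by exists x; rewrite derivn0.
have [|y hy] := IH n.+1; first by rewrite addnS.
by have [z _ hz] := alternates_deriv hy; exists z; rewrite derivnS.
Qed.

(* The sign condition at [0] makes each of the first [n] derivatives lose one of
   the [n] roots that may lie off the positive axis. *)
Lemma fully_alternates_derivn q d n m x : alternates q (d - n) 1 x ->
  size q = d.+1 -> (n <= m)%N -> (m <= d)%N ->
  (forall i, (0 < i <= n)%N -> 0 < (-1) ^+ (d - n) * q`_i) ->
  fully_alternates q^`(m).
Proof.
move=> h sq nm md hq; have [y hy] := alternates_derivn_keep h hq.
(* After [n] derivatives the degree equals the number of sign changes; each of the remaining [m - n]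
   derivatives lowers both by one. *)
have [z hz] : exists z, alternates q^`(m) (d - m) 1 z.
  have -> : q^`(m) = (q^`(n))^`(m - n) by rewrite /derivn -iterD subnK.
  by apply: (alternates_derivn (x := y)); rewrite addnC addnBA// subnK.
exists (d - m)%N, 1, z; split => //.
apply/eqP; rewrite eqn_leq (alternates_size hz) andbT.
apply/leq_sizeP => j hj; rewrite coef_derivn nth_default ?mul0rn// sq; lia.
Qed.

(** Finitely many coefficients are controlled at a time, with no bound on degrees. Convergence of
    values will follow from the positivity of the roots. *)
Definition approximable a := forall eps K, 0 < eps ->
  exists2 q, fully_alternates q & forall k, (k < K)%N -> `|q`_k - a k| < eps.

Lemma approximable_ext a a' : a =1 a' -> approximable a -> approximable a'.
Proof. by move=> /funext ->. Qed.

Lemma approximable_closed a :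
  (forall eps K, 0 < eps -> exists2 a', approximable a' &
      forall k, (k < K)%N -> `|a' k - a k| < eps) -> approximable a.
Proof.
move=> H eps K e0; have e2 : 0 < eps / 2 by rewrite divr_gt0.
have [a' ha' h1] := H _ K e2; have [q hq h2] := ha' _ K e2.
exists q => // k kK; rewrite [eps]splitr.
have -> : q`_k - a k = (q`_k - a' k) + (a' k - a k) by ring.
by rewrite (le_lt_trans (ler_normD _ _))// ltrD ?h1 ?h2.
Qed.

Lemma approximableZ (c : R) a : c != 0 ->
  approximable a -> approximable (fun k => c * a k).
Proof.
move=> c0 h eps K e0; have c0' : 0 < `|c| by rewrite normr_gt0.
have [q hq h2] := h _ K (divr_gt0 e0 c0').
exists (c *: q); first exact: fully_alternatesZ.
move=> k kK; rewrite coefZ -mulrBr normrM mulrC -ltr_pdivlMr//; exact: h2.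
Qed.

(** [euler_op kappa 0] multiplies the coefficient of index [k] by [k + kappa], hence errors below
    index [K] by at most [K + kappa]. *)
Lemma approximable_euler (kappa : R) a : 0 < kappa ->
  approximable a -> approximable (fun k => (k%:R + kappa) * a k).
Proof.
move=> k0 h eps K e0; have c0 : 0 < K%:R + kappa by rewrite ltr_wpDl.
have [q hq h2] := h _ K (divr_gt0 e0 c0).
exists (euler_op kappa 0 q); first exact: fully_alternates_euler_op.
move=> k kK; rewrite coef_euler_op.
have -> : (if k is k'.+1 then 0 * q`_k' else 0) = 0 by case: (k) => // *; rewrite mul0r.
rewrite addr0 -mulrBr normrM.
have k1 : 0 < k%:R + kappa by rewrite ltr_wpDl.
rewrite (gtr0_norm k1); have := h2 k kK; rewrite ltr_pdivlMr// mulrC.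
apply: le_lt_trans; rewrite ler_wpM2r// lerD2r ler_nat; exact: ltnW.
Qed.

End FullAlternation.

(** * Sign changes of products of polynomials *)

Section Products.
Variable R : realType.
Implicit Types (p q : {poly R}).

Lemma coef_comp_scaleX q (c : R) k : (q \Po (c *: 'X))`_k = c ^+ k * q`_k.
Proof.
rewrite comp_polyE coef_sum.
under eq_bigr do rewrite exprZn scalerA coefZ coefXn.
have [kq|qk] := ltnP k (size q); last first.
  rewrite nth_default// mulr0 big1// => i _.
  by rewrite gtn_eqF ?mulr0// (leq_trans _ qk).
rewrite (bigD1 (Ordinal kq))//= eqxx mulr1 mulrC big1 ?addr0// => i.
by rewrite -val_eqE /= eq_sym => /negbTE ->; rewrite mulr0.
Qed.

Lemma avoid_near1 (s : seq R) :
  exists2 d, 0 < d & forall t, 1 < t < 1 + d -> t \notin s.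
Proof.
elim: s => [|l s [d d0 IH]]; first by exists 1.
have [l1|l1] := leP l 1.
  exists d => // t ht; rewrite inE negb_or IH// andbT.
  by rewrite gt_eqF// (le_lt_trans l1)//; case/andP: ht.
exists (Num.min d (l - 1)); first by rewrite lt_min d0 subr_gt0.
move=> t /andP[t1 t2]; rewrite inE negb_or.
have d1 : Num.min d (l - 1) <= d by rewrite ge_min lexx.
have d2 : Num.min d (l - 1) <= l - 1 by rewrite ge_min lexx orbT.
rewrite IH ?andbT; last by rewrite t1 /=; lra.
by rewrite lt_eqF//; lra.
Qed.

(** The roots [r / s] are inserted one at a time; since they are distinct and avoid the roots of
    [q], none is a root of the product already built. *)
Lemma alternates_mul_prod p q (rs : seq R) s n x : 0 < s -> uniq rs ->
  all (fun r => 0 < r) rs -> {in rs, forall r, q.[r / s] != 0} ->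
  alternates q n 1 x ->
  exists y, alternates (((\prod_(r <- rs) ('X - r%:P)) \Po (s *: 'X)) * q)
              (size rs + n) 1 y.
Proof.
move=> s0 + + + h; elim: rs => [|r rs IH].
  by rewrite big_nil comp_polyC mul1r; exists x.
move=> /andP[rrs urs] /andP[r0 rs0] hq.
have [y hy] : exists y, alternates (((\prod_(r <- rs) ('X - r%:P)) \Po (s *: 'X)) * q)
              (size rs + n) 1 y.
  by apply: IH => // t ht; apply: hq; rewrite inE ht orbT.
set P := ((\prod_(r <- rs) ('X - r%:P)) \Po (s *: 'X)) * q in hy.
have Pr : P.[r / s] != 0.
  rewrite /P hornerM mulf_neq0 ?hq ?mem_head//.
  rewrite horner_comp hornerZ hornerX mulrC divfK ?(gt_eqF s0)//.
  by have := root_prod_XsubC rs r; rewrite /root => ->.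
have rs0' : 0 < r / s by rewrite divr_gt0.
pose u := Num.max (r / s) y + 1.
have [||z _ hz] := alternates_insert (u := u) rs0' _ _ hy Pr.
- by rewrite /u ltr_pwDr// le_max lexx.
- by rewrite /u ltr_pwDr// le_max lexx orbT.
exists z.
have -> : ((\prod_(j <- (r :: rs)) ('X - j%:P)) \Po (s *: 'X)) * q =
    s *: (('X - (r / s)%:P) * P).
  have E : ('X - r%:P) \Po (s *: 'X) = s *: ('X - (r / s)%:P).
    rewrite comp_polyB comp_polyX comp_polyC scalerBr; congr (_ - _).
    by rewrite -mul_polyC -polyCM mulrC divfK ?(gt_eqF s0).
  by rewrite big_cons rmorphM /= E /P -!scalerAl mulrA.
by apply: alternatesZ; rewrite (mulrC 1); apply: alternates_scale.
Qed.

(** A root common to both factors would spoil the count of sign changes, so the variable of [p] is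
    rescaled by some [s] close to 1. *)
Lemma alternates_mul p q m n x y d : 0 < d -> p \is monic -> size p = m.+1 ->
  alternates p m 1 x -> alternates q n 1 y ->
  exists s, 1 < s < 1 + d /\
    exists z, alternates ((p \Po (s *: 'X)) * q) (m + n) 1 z.
Proof.
move=> d0 pm sp hp hq.
have [rs [s1 s2 s3 s4]] := alternates_roots hp.
have Ep : p = \prod_(r <- rs) ('X - r%:P).
  rewrite [LHS](@all_roots_prod_XsubC _ p rs) ?s1 ?uniq_rootsE//.
  by rewrite (monicP pm) scale1r.
have q0 : q != 0.
  by apply/eqP => q0; have [_] := alternates_sign hq; rewrite q0 horner0 mulr0 ltxx.
(* These are the values of [s] for which some [r / s] equals a nonzero root [t] of [q]. *)
have [d' d'0 hd'] := avoid_near1 [seq r / t | r <- rs, t <- polyrcf.rootsR q].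
pose s := 1 + Num.min d d' / 2.
have m0 : 0 < Num.min d d' by rewrite lt_min d0.
have m1 : Num.min d d' <= d by rewrite ge_min lexx.
have m2 : Num.min d d' <= d' by rewrite ge_min lexx orbT.
exists s; split; first by rewrite /s; apply/andP; split; lra.
have s0 : 0 < s by rewrite /s; lra.
rewrite Ep -s1; apply: alternates_mul_prod hq => //.
  by apply: sub_all s4 => r /andP[].
move=> r rrs; have r0 : 0 < r by case/andP: (allP s4 _ rrs).
apply/negP => /eqP qrs.
have : s \notin [seq r / t | r <- rs, t <- polyrcf.rootsR q].
  by apply: hd'; rewrite /s; apply/andP; split; lra.
apply/negP; rewrite negbK; apply/allpairsP; exists (r, r / s); split => //=.
  by have := polyrcf.roots_on_rootsR q0 (r / s); rewrite in_itv /= => <-; apply/eqP.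
by rewrite invf_div mulrC divfK ?gt_eqF.
Qed.

End Products.

(** * The hypergeometric series as a limit of polynomials with positive roots *)

Section HypergeometricLimit.
Variable R : realType.
Implicit Types (mu b c : R) (n m k : nat).
Local Open Scope classical_set_scope.

Lemma cvg_bin k :
  (fun N : nat => 'C(N, k)%:R / N%:R ^+ k : R) @ \oo --> (k`!%:R^-1 : R).
Proof.
elim: k => [|k IH].
  rewrite (_ : (fun N => _) = (fun=> 0`!%:R^-1)); first exact: cvg_cst.
  by apply/funext => N; rewrite bin0 expr0 fact0 divr1 invr1.
have inv : (fun N : nat => N%:R^-1 : R) @ \oo --> (0 : R).
  by rewrite -cvg_shiftS; exact: cvg_harmonic.
have h : (fun N : nat => (1 - k%:R * N%:R^-1) * k.+1%:R^-1 : R) @ \oo -->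
    (1 - k%:R * 0) * (k.+1%:R^-1 : R).
  apply: cvgM; last exact: cvg_cst.
  by apply: cvgB; [exact: cvg_cst|apply: cvgM => //; exact: cvg_cst].
rewrite mulr0 subr0 mul1r in h.
have -> : (k.+1`!%:R^-1 : R) = k`!%:R^-1 * k.+1%:R^-1.
  by rewrite factS natrM invfM mulrC.
apply: cvg_trans (cvgM IH h); apply: (@near_eq_cvg _ _ \oo eventually_filter); near=> N => /=.
have N0 : (N%:R : R) != 0 by rewrite pnatr_eq0 -lt0n; near: N; exact: nbhs_infty_gt.
have kN : (k <= N)%N by near: N; exact: nbhs_infty_ge.
have k0 : (k.+1%:R : R) != 0 by rewrite pnatr_eq0.
apply: (mulfI k0); have := mul_bin_left N k.
move=> /(congr1 (fun x => x%:R : R)); rewrite !natrM natrB// => E.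
rewrite [RHS]mulrA E exprS; field; rewrite ?N0 ?natr1 ?nat1r ?k0 ?expf_neq0.
Unshelve. all: by end_near. Qed.

Lemma cvg_pochhammer (u : nat -> R) (l : R) k : u @ \oo --> l ->
  (fun N => pochhammer (u N) k) @ \oo --> pochhammer l k.
Proof.
move=> ul; apply: (cvg_big (@mul_continuous R)) => i _.
by apply: cvgD => //; exact: cvg_cst.
Qed.

(** The coefficient of [x ^ k] in the Laguerre polynomial of degree [M = n + N] taken at [x / (4 M)]
    and normalised to the value 1 at 0. The limit in [N] belongs to ${}_0F_1(1+\mu;-x/4)$; the 4
    absorbs the power of 4 in [clausen_coef]. *)
Definition scaled_coef n mu k (N : nat) : R :=
  (-1) ^+ (n + N) * (4 * (n + N)%:R)^-1 ^+ k * (laguerre (n + N) mu)`_k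
  / pochhammer (1 + mu) (n + N).

Lemma cvg_scaled_coef n mu k : (forall j, pochhammer (1 + mu) j != 0) ->
  scaled_coef n mu k @ \oo -->
  (-1) ^+ k * 4^-1 ^+ k * (k`!%:R * pochhammer (1 + mu) k)^-1.
Proof.
move=> hp.
rewrite (_ : scaled_coef n mu k = (fun M : nat => (-1) ^+ k * 4^-1 ^+ k
      * (('C(M, k)%:R / M%:R ^+ k) * (pochhammer (1 + mu) k)^-1)) \o (addn n)).
  rewrite invfM; apply: (cvg_comp _ _ (cvg_addnl n)).
  apply: cvgM; first exact: cvg_cst.
  by apply: cvgM; [exact: cvg_bin|exact: cvg_cst].
apply/funext => N /=; rewrite /scaled_coef; set M := (n + N)%N.
have E : (laguerre M mu)`_k =
    (-1) ^+ (M + k) * 'C(M, k)%:R * pochhammer (1 + mu) M / pochhammer (1 + mu) k.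
  by rewrite -laguerre_coef mulfK.
have s2 : (-1) ^+ M * (-1) ^+ M = 1 :> R by rewrite -expr2 sqrr_sign.
transitivity (((-1) ^+ M * (-1) ^+ M) * (pochhammer (1 + mu) M / pochhammer (1 + mu) M)
  * ((-1) ^+ k * 4^-1 ^+ k * (('C(M, k)%:R / M%:R ^+ k) / pochhammer (1 + mu) k))).
  by rewrite E invfM exprMn exprD [M%:R^-1 ^+ k]exprVn; ring.
by rewrite s2 mulfV// !mul1r.
Qed.

Lemma pochhammer_neg_sign n mu k : n%:R < mu -> (k <= n)%N ->
  0 < (-1) ^+ k * pochhammer (1 - mu) k.
Proof.
move=> nmu; elim: k => [|k IH] kn; first by rewrite pochhammer0 mulr1.
rewrite pochhammerSr exprS.
have -> : -1 * (-1) ^+ k * (pochhammer (1 - mu) k * (1 - mu + k%:R)) =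
  (-1) ^+ k * pochhammer (1 - mu) k * (mu - k.+1%:R) by rewrite -natr1; ring.
rewrite mulr_gt0 ?IH//; first exact: ltnW.
by rewrite subr_gt0 (le_lt_trans _ nmu)// ler_nat.
Qed.

(** Exactly the first [n] factors, [1 - mu] to [n - mu], are negative. *)
Lemma pochhammer_neg_sign_ge n mu k : n%:R < mu < n.+1%:R -> (n <= k)%N ->
  0 < (-1) ^+ n * pochhammer (1 - mu) k.
Proof.
move=> /andP[nmu mun] nk; rewrite -(subnKC nk) pochhammerD mulrA mulr_gt0//.
  exact: pochhammer_neg_sign nmu _.
by apply: pochhammer_gt0; rewrite -natr1 in mun; lra.
Qed.

Lemma pochhammer_neg_neq0 n mu k : n%:R < mu < n.+1%:R ->
  pochhammer (1 - mu) k != 0.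
Proof.
move=> h; have [nk|kn] := leqP n k.
  by have := pochhammer_neg_sign_ge h nk; apply: contraTneq => ->; rewrite mulr0 ltxx.
have /andP[h1 _] := h.
have := pochhammer_neg_sign h1 (ltnW kn).
by apply: contraTneq => ->; rewrite mulr0 ltxx.
Qed.

(* Since [1F2(1/2; 1 + mu, 1 - mu; -x)] is a product of Bessel functions of
   orders [mu] and [- mu], products of Laguerre polynomials approximate it. *)
Lemma laguerre_product n mu N (d : R) : n%:R < mu < n.+1%:R -> (0 < N)%N ->
    0 < d ->
  exists s, 1 < s < 1 + d /\ exists P : {poly R},
    [/\ size P = (n + N + (n + N)).+1,
        exists z, alternates P (n + N + N) 1 z
      & exists2 c, 0 < (-1) ^+ n * c &
        forall k, c * P`_k = \sum_(i < k.+1)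
          s ^+ i * scaled_coef n mu i N * scaled_coef n (- mu) (k - i) N].
Proof.
move=> hmu N0 d0; have /andP[mu1 mu2] := hmu; set M := (n + N)%N.
have mu0 : 0 < mu by apply: le_lt_trans mu1.
have [x hx] : exists x, alternates (laguerre M mu) M 1 x.
  by apply: laguerre_alternates_gtN1; lra.
have [y hy] : exists y, alternates (laguerre M (- mu)) N 1 y.
  by apply: laguerre_alternates; rewrite -natr1 in mu2; lra.
have [||s [hs [z hz]]] := alternates_mul d0 _ _ hx hy.
- by rewrite monicE lead_coef_laguerre.
- exact: size_laguerre.
exists s; split => //.
have s0 : 0 < s by case/andP: hs => h _; apply: lt_trans h.
pose t : R := (4 * M%:R)^-1.
have t0 : 0 < t by rewrite invr_gt0 mulr_gt0// ltr0n /M addn_gt0 N0 orbT.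
have size_scaleX (c : R) : 0 < c -> size (c *: 'X : {poly R}) = 2%N.
  by move=> c0; rewrite size_scale ?size_polyX// gt_eqF.
exists (((laguerre M mu \Po (s *: 'X)) * laguerre M (- mu)) \Po (t *: 'X)); split.
- rewrite size_comp_poly2 ?size_scaleX// size_mul.
  + by rewrite size_comp_poly2 ?size_scaleX// !size_laguerre addSn addnS.
  + by rewrite -size_poly_eq0 size_comp_poly2 ?size_scaleX// size_laguerre.
  + by rewrite -size_poly_eq0 size_laguerre.
- by exists (z / t); apply: alternates_comp_scale.
(* This normalises both Laguerre factors at 0, the two signs [(-1) ^+ M] cancelling; its own sign
   comes from [pochhammer (1 - mu) M]. *)
exists (pochhammer (1 + mu) M * pochhammer (1 - mu) M)^-1.
  rewrite invfM mulrCA mulr_gt0// ?invr_gt0 ?pochhammer_gt0//; first lra.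
  rewrite -invr_signM invr_gt0.
  by apply: pochhammer_neg_sign_ge hmu _; rewrite /M leq_addr.
move=> k; rewrite coef_comp_scaleX coefM !mulr_sumr; apply: eq_bigr => i _.
have ik : (i <= k)%N by rewrite -ltnS.
rewrite coef_comp_scaleX /scaled_coef -/M -/t.
have s2 : (-1) ^+ M * (-1) ^+ M = 1 :> R by rewrite -expr2 sqrr_sign.
have tk : t ^+ k = t ^+ i * t ^+ (k - i) by rewrite -exprD subnKC.
rewrite tk invfM; set u := (-1) ^+ M in s2 *; set q1 := (pochhammer _ _)^-1.
set q2 := (pochhammer _ _)^-1.
set p1 := (laguerre _ _)`_ _; set p2 := (laguerre _ _)`_ _.
transitivity (u * u * (q1 * q2 * (t ^+ i * t ^+ (k - i) * (s ^+ i * p1 * p2)))).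
  by rewrite s2 mul1r.
ring.
Qed.

(** The [m]-th derivatives of the Laguerre products also converge coefficientwise, and
    differentiating the limit [m] times raises its three parameters by [m]. *)
Lemma approximable_noninteger n m mu : n%:R < mu < n.+1%:R -> (n <= m)%N ->
  approximable (hyp1F2_term (1 / 2 + m%:R) (m.+1%:R + mu) (m.+1%:R - mu) (-1)).
Proof.
move=> hmu nm; have /andP[mu1 mu2] := hmu.
have mu0 : 0 < mu by apply: le_lt_trans mu1.
have pos_neq0 j : pochhammer (1 + mu) j != 0.
  by rewrite gt_eqF// pochhammer_gt0//; lra.
have neg_neq0 j := pochhammer_neg_neq0 j hmu.
have /choice[s hs] := fun N => laguerre_product hmu (ltn0Sn N) (harmonic_gt0 (R := R) N).
have /choice[P hP] := fun N => (hs N).2.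
have /choice[c hc] : forall N, exists c, 0 < (-1) ^+ n * c /\
    forall k, c * (P N)`_k = \sum_(i < k.+1) s N ^+ i * scaled_coef n mu i N.+1
       * scaled_coef n (- mu) (k - i) N.+1.
  by move=> N; have [_ _ [c c1 c2]] := hP N; exists c.
have cvgs : s @ \oo --> (1 : R).
  have h1 : (fun N => 1 + harmonic N : R) @ \oo --> (1 + 0 : R).
    by apply: cvgD; [exact: cvg_cst|exact: cvg_harmonic].
  rewrite addr0 in h1; apply: (squeeze_cvgr _ (cvg_cst (1 : R)) h1).
  by near=> N; have [/andP[h2 h3] _] := hs N; rewrite !ltW.
pose phi k : R := (-1) ^+ k * (pochhammer (1 / 2) k
              / (k`!%:R * pochhammer (1 + mu) k * pochhammer (1 - mu) k)).
(* The limits of the two Laguerre factors are Bessel series, whose Cauchy product is computed by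
   [clausen_coef]. *)
have cvgP k : (fun N => c N * (P N)`_k) @ \oo --> phi k.
  have -> : (fun N => c N * (P N)`_k) = (fun N => \sum_(i < k.+1)
      s N ^+ i * scaled_coef n mu i N.+1 * scaled_coef n (- mu) (k - i) N.+1).
    by apply/funext => N; rewrite (hc N).2.
  have -> : phi k = \sum_(i < k.+1) 1 ^+ i
      * ((-1) ^+ i * 4^-1 ^+ i * (i`!%:R * pochhammer (1 + mu) i)^-1)
      * ((-1) ^+ (k - i) * 4^-1 ^+ (k - i)
           * ((k - i)`!%:R * pochhammer (1 - mu) (k - i))^-1).
    transitivity ((-1) ^+ k * 4^-1 ^+ k * (4 ^+ k * (pochhammer (1 / 2) k
              / (k`!%:R * pochhammer (1 + mu) k * pochhammer (1 - mu) k)))).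
      rewrite /phi [RHS]mulrA; congr (_ * _).
      by rewrite -mulrA -exprMn mulVf ?expr1n ?mulr1.
    rewrite -clausen_coef// mulr_sumr; apply: eq_bigr => i _.
    have ik : (i <= k)%N by rewrite -ltnS.
    have eN : (-1) ^+ k = (-1) ^+ i * (-1) ^+ (k - i) :> R by rewrite -exprD subnKC.
    have e4 : 4^-1 ^+ k = 4^-1 ^+ i * 4^-1 ^+ (k - i) :> R by rewrite -exprD subnKC.
    rewrite eN e4 expr1n; ring.
  apply: (cvg_big (@add_continuous R)) => i _.
  apply: cvgM; first apply: cvgM.
  - exact: (cvg_comp s (fun x => x ^+ i) cvgs (@exprn_continuous R i 1)).
  - by have := @cvg_scaled_coef n mu i pos_neq0; rewrite -cvg_shiftS.
  - by have := @cvg_scaled_coef n (- mu) (k - i) neg_neq0; rewrite -cvg_shiftS.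
(* For [j <= n] the sign [(-1) ^+ j] cancels that of [pochhammer (1 - mu) j]. This supplies the sign
   condition of [fully_alternates_derivn]. *)
have phi0 j : (j <= n)%N -> 0 < phi j.
  move=> jn; have hj := pochhammer_neg_sign mu1 jn.
  have -> : phi j = pochhammer (1 / 2) j / (j`!%:R * pochhammer (1 + mu) j)
      / ((-1) ^+ j * pochhammer (1 - mu) j).
    by rewrite /phi [((-1) ^+ j * _)^-1]invfM -exprVn invrN1 [(_ * _ * _)^-1]invfM; ring.
  rewrite divr_gt0// divr_gt0 ?mulr_gt0 ?pochhammer_gt0 ?ltr0n ?fact_gt0//; lra.
have target k : hyp1F2_term (1 / 2 + m%:R) (m.+1%:R + mu) (m.+1%:R - mu) (-1) k =
    ((-1) ^+ m * pochhammer (1 / 2) m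
      / (pochhammer (1 + mu) m * pochhammer (1 - mu) m))^-1
    * (phi (m + k)%N * ((m + k) ^_ m)%:R).
  have E1 : 1 + mu + m%:R = m.+1%:R + mu by rewrite -natr1; ring.
  have E2 : 1 - mu + m%:R = m.+1%:R - mu by rewrite -natr1; ring.
  have := pos_neq0 (m + k)%N; rewrite pochhammerD E1 mulf_eq0 negb_or => /andP[a1 a2].
  have := neg_neq0 (m + k)%N; rewrite pochhammerD E2 mulf_eq0 negb_or => /andP[b1 b2].
  rewrite /hyp1F2_term /phi !pochhammerD E1 E2 exprD.
  have f0 : k`!%:R != 0 :> R by rewrite pnatr_eq0 -lt0n fact_gt0.
  have h0 : pochhammer (1 / 2 : R) m != 0 by rewrite gt_eqF// pochhammer_gt0.
  have e1 : ((m + k)`!%:R : R) = ((m + k) ^_ m)%:R * k`!%:R.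
    by rewrite -natrM -(ffact_fact (leq_addr k m)) addKn.
  have ff0 : ((m + k) ^_ m)%:R != 0 :> R by rewrite pnatr_eq0 -lt0n ffact_gt0 leq_addr.
  rewrite e1; field.
  by rewrite a1 a2 b1 b2 f0 h0 ff0 ?expf_neq0 ?oppr_eq0 ?oner_eq0.
apply: (approximable_ext (fun k => esym (target k))).
apply: approximableZ.
  rewrite invr_neq0// mulf_neq0 ?invr_neq0// ?mulf_neq0//.
    by rewrite expf_neq0// oppr_eq0 oner_eq0.
  by rewrite gt_eqF// pochhammer_gt0.
move=> eps K eps0.
have cN0 N : c N != 0.
  by have [h _] := hc N; apply: contraTneq h => ->; rewrite mulr0 ltxx.
have near_coef : \forall N \near \oo, forall i : 'I_K,
    `|(c N * (P N)`_(m + i)) * ((m + i) ^_ m)%:R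
      - phi (m + i)%N * ((m + i) ^_ m)%:R| < eps.
  apply: filter_forall => i.
  have h : (fun N => (c N * (P N)`_(m + i)) * ((m + i) ^_ m)%:R) @ \oo -->
      phi (m + i)%N * ((m + i) ^_ m)%:R.
    by apply: cvgM; [exact: cvgP|exact: cvg_cst].
  move/cvgrPdist_lt : h => /(_ _ eps0); apply: filterS => N /=.
  by rewrite distrC.
have near_sign : \forall N \near \oo, forall i : 'I_n.+1, 0 < c N * (P N)`_i.
  apply: filter_forall => i; apply: (cvgr_gt _ (cvgP i)).
  by apply: phi0; rewrite -ltnS.
have [N [h1 h2 h3]] : exists N, [/\ (m <= N)%N, forall i : 'I_n.+1, 0 < c N * (P N)`_i
    & forall i : 'I_K, `|(c N * (P N)`_(m + i)) * ((m + i) ^_ m)%:R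
      - phi (m + i)%N * ((m + i) ^_ m)%:R| < eps].
  near \oo => N; exists N; split; last by near: N.
    by near: N; exact: nbhs_infty_ge.
  by near: N.
have [sP [z hz] _] := hP N; have [cn _] := hc N.
exists (c N *: (P N)^`(m)).
  apply: fully_alternatesZ => //.
  apply: (fully_alternates_derivn (d := (n + N.+1 + (n + N.+1))%N) (n := n) (x := z)) => //.
  - by rewrite (_ : (_ - n)%N = (n + N.+1 + N.+1)%N)//; lia.
  - lia.
  - move=> i /andP[_ ik].
    have := h2 (Ordinal (ik : (i < n.+1)%N)) => /= h4.
    (* The number of sign changes has the parity of [n]. Multiplying by [c N ^+ 2] then replaces the
       sign of a coefficient of [P N] by the known signs of [(-1) ^+ n * c N] and of [c N] times
       that coefficient. *)
    have -> : (n + N.+1 + (n + N.+1) - n)%N = (n + (N.+1 + N.+1))%N by lia.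
    have c2 : 0 < c N ^+ 2 by rewrite lt_def sqr_ge0 sqrf_eq0 cN0.
    rewrite exprD (exprD _ N.+1) -expr2 sqrr_sign mulr1 -(pmulr_lgt0 _ c2).
    have -> : (-1) ^+ n * (P N)`_i * c N ^+ 2 = ((-1) ^+ n * c N) * (c N * (P N)`_i).
      by ring.
    exact: mulr_gt0.
move=> k kK; have := h3 (Ordinal kK).
by rewrite coefZ coef_derivn -[in X in _ -> X](mulr_natr (P N)`_(m + k)) mulrA.
Unshelve. all: by end_near. Qed.

(* The values [b + c = 2 m + 2] with [(b - c) / 2] an integer are reached as
   limits. *)
Lemma approximable_top m mu : 0 <= mu -> mu < m.+1%:R ->
  approximable (hyp1F2_term (1 / 2 + m%:R) (m.+1%:R + mu) (m.+1%:R - mu) (-1)).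
Proof.
move=> mu0 mum; have /andP[n1 n2] := truncn_itv mu0; set n := Num.truncn mu in n1 n2.
have nm : (n <= m)%N by rewrite -ltnS -(ltr_nat R) (le_lt_trans n1).
pose d := n.+1%:R - mu.
have d0 : 0 < d by rewrite subr_gt0.
(* The shifted index makes the factor of [d] less than 1, so [mu + u N] lies strictly between [n]
   and [n + 1] even when [mu = n]. *)
pose u N : R := d * harmonic N.+1.
have cu : u @ \oo --> (0 : R).
  rewrite -(mulr0 d); apply: cvgM; first exact: cvg_cst.
  by have := @cvg_harmonic R; rewrite -cvg_shiftS.
have hu N : n%:R < mu + u N < n.+1%:R.
  have h : 0 < (harmonic N.+1 : R) < 1.
    by rewrite harmonic_gt0 /= invf_lt1 ?ltr0n// ltr1n.
  have {h}/andP[h1 h2] := h.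
  have u0 : 0 < u N by rewrite mulr_gt0.
  have ud : u N < d by rewrite gtr_pMr.
  by rewrite /d in ud; apply/andP; split; lra.
apply: approximable_closed => eps K eps0.
pose A N := hyp1F2_term (1 / 2 + m%:R) (m.+1%:R + (mu + u N)) (m.+1%:R - (mu + u N)) (-1).
have cA k : (A ^~ k) @ \oo -->
    hyp1F2_term (1 / 2 + m%:R) (m.+1%:R + mu) (m.+1%:R - mu) (-1) k.
  have c1 : (fun N => mu + u N) @ \oo --> mu.
    by rewrite -[X in _ --> X]addr0; apply: cvgD => //; exact: cvg_cst.
  rewrite /A /hyp1F2_term; apply: cvgM; last exact: cvg_cst.
  apply: cvgM; first exact: cvg_cst.
  apply: cvgV.
    rewrite !mulf_neq0// ?pnatr_eq0 -?lt0n ?fact_gt0//; rewrite gt_eqF// pochhammer_gt0//.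
      by rewrite ltr_wpDr.
    by rewrite subr_gt0.
  apply: cvgM; first apply: cvgM; first exact: cvg_cst.
    by apply: cvg_pochhammer; apply: cvgD => //; exact: cvg_cst.
  by apply: cvg_pochhammer; apply: cvgB => //; exact: cvg_cst.
have near_coef : \forall N \near \oo, forall i : 'I_K,
    `|A N i - hyp1F2_term (1 / 2 + m%:R) (m.+1%:R + mu) (m.+1%:R - mu) (-1) i| < eps.
  apply: filter_forall => i.
  move/cvgrPdist_lt : (cA i) => /(_ _ eps0); apply: filterS => N /=.
  by rewrite distrC.
have [N hN] : exists N, forall i : 'I_K,
    `|A N i - hyp1F2_term (1 / 2 + m%:R) (m.+1%:R + mu) (m.+1%:R - mu) (-1) i| < eps.
  by near \oo => N; exists N; near: N.
exists (A N); first exact: approximable_noninteger (hu N) nm.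
by move=> k kK; exact: (hN (Ordinal kK)).
Unshelve. all: by end_near. Qed.

(** Passing from [b + 1] to [b] multiplies the coefficient of index [k] by [(k + b) / b], which is
    the action of [euler_op b 0] up to a constant. *)
Lemma approximable_lower m b c : 0 < b ->
  approximable (hyp1F2_term (1 / 2 + m%:R) (b + 1) c (-1)) ->
  approximable (hyp1F2_term (1 / 2 + m%:R) b c (-1)).
Proof.
move=> b0 h; have b1 : b != 0 by rewrite gt_eqF.
have := approximableZ (invr_neq0 b1) (approximable_euler b0 h).
apply: approximable_ext => k; rewrite /hyp1F2_term.
have kb : k%:R + b != 0 by rewrite gt_eqF// ltr_wpDl.
have : pochhammer b k * (b + k%:R) = b * pochhammer (b + 1) k.
  by rewrite -pochhammerSr pochhammerSl.
rewrite addrC => /(canRL (mulfK kb)) ->.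
by rewrite !invfM invrK; ring.
Qed.

(** Raising [b] by [j] reaches the line where the parameters sum to [2 m + 2], and [j] applications
    of [approximable_lower] lead back. *)
Lemma approximable_1F2 m k b c : (1 <= k <= 2 * m + 2)%N -> 0 < b -> 0 < c ->
  b + c = k%:R -> approximable (hyp1F2_term (1 / 2 + m%:R) b c (-1)).
Proof.
move=> /andP[_ km] b0 c0 bck.
pose j := (2 * m + 2 - k)%N.
have bcj : b + j%:R + c = 2 * m.+1%:R.
  rewrite addrAC bck -natrD subnKC// -natrM; congr _%:R; lia.
suff h : approximable (hyp1F2_term (1 / 2 + m%:R) (b + j%:R) c (-1)).
  elim: (j) h => [|i IH]; first by rewrite addr0.
  by rewrite -[i.+1%:R]natr1 addrA => h; apply/IH/approximable_lower => //; rewrite ltr_wpDr.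
have bj0 : 0 < b + j%:R by rewrite ltr_wpDr.
move: (b + j%:R) bj0 bcj => {b0 bck}b b0 bc.
(* By symmetry the larger parameter is [m + 1 + mu] with [mu >= 0]; positivity of the smaller one
   gives [mu < m + 1]. *)
have [cb|cb] := leP c b.
  have -> : b = m.+1%:R + (b - m.+1%:R) by ring.
  have -> : c = m.+1%:R - (b - m.+1%:R) by lra.
  by apply: approximable_top; lra.
have -> : hyp1F2_term (1 / 2 + m%:R) b c (-1) = hyp1F2_term (1 / 2 + m%:R) c b (-1).
  by apply/funext => i; rewrite /hyp1F2_term [_ * pochhammer b _ * _]mulrAC.
have -> : c = m.+1%:R + (c - m.+1%:R) by ring.
have -> : b = m.+1%:R - (c - m.+1%:R) by lra.
by apply: approximable_top; lra.
Qed.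

End HypergeometricLimit.

(** * Modulus, convergence and exponential estimates over the complex numbers *)

Section ComplexConvergence.
Variable R : realType.
Implicit Types (z w : R[i]).
Local Notation Re := complex.Re.
Local Notation Im := complex.Im.
Local Open Scope classical_set_scope.

(* The modulus as an element of [R]; the norm of [R[i]] is [R[i]]-valued. *)
Definition cabs z : R := Num.sqrt (Re z ^+ 2 + Im z ^+ 2).

Lemma normr_cabs z : `|z| = (cabs z)%:C.
Proof. exact: normc_def. Qed.

Lemma cabs_ge0 z : 0 <= cabs z.
Proof. exact: sqrtr_ge0. Qed.
Hint Resolve cabs_ge0 : core.

Lemma cabsM z w : cabs (z * w) = cabs z * cabs w.
Proof. by have := normrM z w; rewrite !normr_cabs -rmorphM => /complexI. Qed.

Lemma cabsD z w : cabs (z + w) <= cabs z + cabs w.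
Proof. by have := ler_normD z w; rewrite !normr_cabs -rmorphD lecR. Qed.

Lemma cabsN z : cabs (- z) = cabs z.
Proof. by apply: complexI; rewrite -!normr_cabs normrN. Qed.

Lemma cabsB z w : cabs (z - w) <= cabs z + cabs w.
Proof. by rewrite -(cabsN w) cabsD. Qed.

Lemma cabs_real (x : R) : cabs x%:C = `|x|.
Proof. by rewrite /cabs /= expr0n addr0 sqrtr_sqr. Qed.

Lemma cabs0 : cabs 0 = 0.
Proof. by have := cabs_real 0; rewrite normr0. Qed.

Lemma cabs1 : cabs 1 = 1.
Proof. by have := cabs_real 1; rewrite normr1. Qed.

Lemma cabs_eq0 z : cabs z = 0 -> z = 0.
Proof. by move=> h; apply/eqP; rewrite -normr_eq0 normr_cabs h. Qed.

Lemma cabsX z n : cabs (z ^+ n) = cabs z ^+ n.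
Proof. by elim: n => [|n IH]; rewrite ?expr0 ?cabs1// !exprS cabsM IH. Qed.

Lemma cabsV z : cabs z^-1 = (cabs z)^-1.
Proof. by have := normfV z; rewrite !normr_cabs -fmorphV => /complexI. Qed.

Lemma cabs_sum (I : Type) (r : seq I) (P : pred I) (F : I -> R[i]) :
  cabs (\sum_(i <- r | P i) F i) <= \sum_(i <- r | P i) cabs (F i).
Proof.
elim/big_rec2 : _ => [|i x y _ h]; first by rewrite cabs0.
by rewrite (le_trans (cabsD _ _))// lerD2l.
Qed.

Lemma normRe_le_cabs z : `|Re z| <= cabs z.
Proof. by rewrite -sqrtr_sqr ler_wsqrtr// lerDl sqr_ge0. Qed.

Lemma normIm_le_cabs z : `|Im z| <= cabs z.
Proof. by rewrite -sqrtr_sqr ler_wsqrtr// lerDr sqr_ge0. Qed.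

Lemma cabs_le_ReIm z : cabs z <= `|Re z| + `|Im z|.
Proof.
rewrite -[leRHS]ger0_norm ?addr_ge0// -sqrtr_sqr ler_wsqrtr//.
by rewrite sqrrD !real_normK ?num_real// lerD2r lerDl mulrn_wge0// mulr_ge0.
Qed.

Lemma ReD z w : Re (z + w) = Re z + Re w. Proof. by case: z w => [? ?] [? ?]. Qed.
Lemma ImD z w : Im (z + w) = Im z + Im w. Proof. by case: z w => [? ?] [? ?]. Qed.
Lemma ReN z : Re (- z) = - Re z. Proof. by case: z. Qed.
Lemma ImN z : Im (- z) = - Im z. Proof. by case: z. Qed.
Lemma ReM z w : Re (z * w) = Re z * Re w - Im z * Im w.
Proof. by case: z w => [? ?] [? ?]. Qed.
Lemma ImM z w : Im (z * w) = Re z * Im w + Im z * Re w.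
Proof. by case: z w => [? ?] [? ?]; rewrite /= addrC. Qed.
Lemma ReM_real (x : R) z : Re (x%:C * z) = x * Re z.
Proof. by rewrite ReM /= mul0r subr0. Qed.
Lemma ImM_real (x : R) z : Im (x%:C * z) = x * Im z.
Proof. by rewrite ImM /= mul0r addr0. Qed.

(** Convergence by real and imaginary parts reduces everything to real limits. The filter is
    arbitrary because limits along an ultrafilter are taken later; [ccvg_cvg] is the link with the
    topology of [R[i]^o]. *)
Definition ccvg {T : Type} (F : set_system T) (f : T -> R[i]) (l : R[i]) :=
  (fun t => Re (f t)) @ F --> Re l /\ (fun t => Im (f t)) @ F --> Im l.

Section Filter.
Context {T : Type} {F : set_system T} {FF : Filter F}.
Implicit Types (f g : T -> R[i]) (l : R[i]).

Lemma ccvgP f l : ccvg F f l <->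
  forall eps : R, 0 < eps -> \forall t \near F, cabs (f t - l) < eps.
Proof.
split=> [[/cvgrPdist_lt h1 /cvgrPdist_lt h2] eps e0|h].
  have e2 : 0 < eps / 2 by rewrite divr_gt0.
  apply: filterS2 (h1 _ e2) (h2 _ e2) => t t1 t2.
  rewrite (le_lt_trans (cabs_le_ReIm _))// ReD ImD ReN ImN distrC [`|Im _ - _|]distrC.
  by rewrite [eps]splitr ltrD.
split; apply/cvgrPdist_lt => eps e0; apply: filterS (h _ e0) => t ht.
  by rewrite distrC -ReN -ReD (le_lt_trans (normRe_le_cabs _)).
by rewrite distrC -ImN -ImD (le_lt_trans (normIm_le_cabs _)).
Qed.

Lemma ccvg_cvg f l : ccvg F f l <-> ((f : T -> R[i]^o) @ F --> (l : R[i]^o)).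
Proof.
split=> [/ccvgP h|/cvgrPdist_lt h].
  (* The tolerance is an element of [R[i]]; being positive, it is real. *)
  apply/cvgrPdist_lt => eps; rewrite ltcE /= => /andP[/eqP i0 r0].
  apply: filterS (h _ r0) => t ht.
  rewrite [`|_|](normr_cabs (l - f t)) ltcE /= i0 eqxx /=.
  by rewrite -opprB cabsN.
apply/ccvgP => eps e0; have e0' : 0 < eps%:C :> R[i] by rewrite ltcR.
apply: filterS (h _ e0') => t.
by rewrite [`|_|](normr_cabs (l - f t)) ltcR -opprB cabsN.
Qed.

Lemma ccvg_cst l : ccvg F (fun=> l) l.
Proof. by split; exact: cvg_cst. Qed.

Lemma ccvgD f g l l' : ccvg F f l -> ccvg F g l' ->
  ccvg F (fun t => f t + g t) (l + l').
Proof.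
move=> [f1 f2] [g1 g2]; split; rewrite ?ReD ?ImD;
  under eq_fun do rewrite ?ReD ?ImD; exact: cvgD.
Qed.

Lemma ccvgN f l : ccvg F f l -> ccvg F (fun t => - f t) (- l).
Proof.
move=> [f1 f2]; split; rewrite ?ReN ?ImN;
  under eq_fun do rewrite ?ReN ?ImN; exact: cvgN.
Qed.

Lemma ccvgB f g l l' : ccvg F f l -> ccvg F g l' ->
  ccvg F (fun t => f t - g t) (l - l').
Proof. by move=> h h'; apply: ccvgD => //; exact: ccvgN. Qed.

Lemma ccvgM f g l l' : ccvg F f l -> ccvg F g l' ->
  ccvg F (fun t => f t * g t) (l * l').
Proof.
move=> [f1 f2] [g1 g2]; split; rewrite ?ReM ?ImM;
  under eq_fun do rewrite ?ReM ?ImM.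
  by apply: cvgB; apply: cvgM.
by apply: cvgD; apply: cvgM.
Qed.

Lemma ccvg_real (u : T -> R) (x : R) : u @ F --> x -> ccvg F (fun t => (u t)%:C) x%:C.
Proof. by move=> h; split => //=; exact: cvg_cst. Qed.

Lemma ccvg_prod (I : Type) (r : seq I) (f : I -> T -> R[i]) (l : I -> R[i]) :
  (forall i, ccvg F (f i) (l i)) ->
  ccvg F (fun t => \prod_(i <- r) f i t) (\prod_(i <- r) l i).
Proof.
move=> h; elim: r => [|i r IH].
  by rewrite big_nil; under eq_fun do rewrite big_nil; exact: ccvg_cst.
by rewrite big_cons; under eq_fun do rewrite big_cons; exact: ccvgM.
Qed.

Lemma ccvg_cabs_cvg f l : ccvg F f l -> (fun t => cabs (f t)) @ F --> cabs l.
Proof.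
move=> [h1 h2]; rewrite /cabs.
apply: (@cvg_comp _ _ _ _ Num.sqrt F (nbhs (Re l ^+ 2 + Im l ^+ 2))).
  by rewrite !expr2; apply: cvgD; apply: cvgM.
exact: sqrt_continuous.
Qed.

End Filter.

Lemma ccvg_cabs_le {T : topologicalType} {F : set_system T} {FF : ProperFilter F}
    (f : T -> R[i]) (l : R[i]) (B : R) :
  ccvg F f l -> (\forall t \near F, cabs (f t) <= B) -> cabs l <= B.
Proof.
by move=> h hB; apply: (ler_cvg_to (ccvg_cabs_cvg h) (cvg_cst B)).
Qed.

Lemma ccvg_lim (f : nat -> R[i]) (l : R[i]) : ccvg \oo f l ->
  limn (f : nat -> R[i]^o) = l.
Proof.
move=> h; apply: (@cvg_lim _ _ _ \oo) => //; exact/ccvg_cvg.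
Qed.

Lemma cexpD z w : cexp (z + w) = cexp z * cexp w.
Proof.
rewrite /cexp ReD ImD expRD cosD sinD rmorphM mulrACA; congr (_ * _).
by apply/eqP; rewrite eq_complex /=; apply/andP; split; apply/eqP; ring.
Qed.

Lemma cexp0 : cexp (0 : R[i]) = 1.
Proof. by rewrite /cexp /= expR0 cos0 sin0 mul1r. Qed.

Lemma cexpN_mul z : cexp (- z) * cexp z = 1.
Proof. by rewrite -cexpD addNr cexp0. Qed.

Lemma cabs_cexp z : cabs (cexp z) = expR (Re z).
Proof.
rewrite /cexp cabsM cabs_real ger0_norm ?expR_ge0//.
by rewrite /cabs /= cos2Dsin2 sqrtr1 mulr1.
Qed.

Lemma cabs_cexp_le z : cabs (cexp z) <= expR (cabs z).
Proof. by rewrite cabs_cexp ler_expR (le_trans (ler_norm _))// normRe_le_cabs. Qed.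

Lemma ccvg_cexp {T : Type} {F : set_system T} {FF : Filter F}
    (f : T -> R[i]) (l : R[i]) : ccvg F f l -> ccvg F (fun t => cexp (f t)) (cexp l).
Proof.
move=> [h1 h2]; apply: ccvgM.
  apply: ccvg_real; apply: (cvg_comp _ _ h1); exact: continuous_expR.
by split => /=; apply: (cvg_comp _ _ h2);
  [exact: continuous_cos|exact: continuous_sin].
Qed.

Lemma expR_sub1_le (x : R) : `|expR x - 1| <= `|x| * expR `|x|.
Proof.
have h : expR x - 1 <= x * expR x.
  have := expR_ge1Dx (- x); rewrite expRN -[leRHS]mul1r ler_pdivlMr ?expR_gt0//.
  by rewrite mulrDl mul1r mulNr; lra.
have h' := expR_ge1Dx x.
have [x0|x0] := leP 0 x; first by rewrite !ger0_norm//; lra.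
rewrite (ltr0_norm x0) ler0_norm; last by rewrite subr_le0 expR_le1 ltW.
have h1 : 1 <= expR (- x) by rewrite -expR0 ler_expR oppr_ge0 ltW.
rewrite (@le_trans _ _ (- x))//; first lra.
by rewrite ler_peMr// oppr_ge0 ltW.
Qed.

Lemma expR_sub1x_le (x : R) : `|expR x - 1 - x| <= x ^+ 2 * expR `|x|.
Proof.
rewrite ger0_norm; last by have := expR_ge1Dx x; lra.
have h : expR x - 1 - x <= x * (expR x - 1).
  have := expR_ge1Dx (- x); rewrite expRN -[leRHS]mul1r ler_pdivlMr ?expR_gt0//.
  by rewrite mulrDl mul1r mulNr; lra.
rewrite (le_trans h)// (le_trans (ler_norm _))// normrM.
rewrite -(real_normK (num_real x)) expr2 -mulrA ler_wpM2l//; exact: expR_sub1_le.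
Qed.

Lemma normr_sin_le (x : R) : `|sin x| <= `|x|.
Proof.
wlog x0 : x / 0 < x.
  move=> H; have [x0|x0|<-] := ltgtP 0 x; [exact: H| |by rewrite sin0].
  by rewrite -normrN -sinN -[leRHS]normrN H// oppr_gt0.
have [c _] := @MVT R sin cos 0 x x0 (fun t _ => is_derive_sin t)
  (continuous_subspaceT (@continuous_sin R)).
by rewrite sin0 !subr0 => ->; rewrite normrM ler_piMl// cos_max.
Qed.

Lemma cos_sub1E (x : R) : cos x - 1 = - (sin (x / 2) ^+ 2 *+ 2).
Proof.
have {1}-> : x = (x / 2) *+ 2 by rewrite -mulr_natr divfK.
rewrite cos_mulr2n; have := cos2Dsin2 (x / 2) => h.
have -> : cos (x / 2) ^+ 2 = 1 - sin (x / 2) ^+ 2 by lra.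
ring.
Qed.

Lemma cos_sub1_le (x : R) : `|cos x - 1| <= x ^+ 2.
Proof.
rewrite cos_sub1E normrN ger0_norm ?mulrn_wge0 ?sqr_ge0//.
have h := normr_sin_le (x / 2).
have : sin (x / 2) ^+ 2 <= (x / 2) ^+ 2.
  by rewrite -(real_normK (num_real (sin _))) -(real_normK (num_real (x / 2))) lerXn2r ?nnegrE.
rewrite expr_div_n -mulr_natr; have := sqr_ge0 x; lra.
Qed.

Lemma cos_sub1_le_norm (x : R) : `|cos x - 1| <= `|x|.
Proof.
rewrite cos_sub1E normrN ger0_norm ?mulrn_wge0 ?sqr_ge0//.
have h := normr_sin_le (x / 2); have h1 := sin_max (x / 2).
have : sin (x / 2) ^+ 2 <= `|sin (x / 2)|.
  by rewrite -(real_normK (num_real (sin _))) expr2 ler_piMl.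
move: h; rewrite normrM [`|2^-1|]ger0_norm ?invr_ge0// -mulr_natr; lra.
Qed.

Lemma sin_sub_le (x : R) : `|sin x - x| <= x ^+ 2.
Proof.
wlog x0 : x / 0 < x.
  move=> H; have [x0|x0|<-] := ltgtP 0 x; [exact: H| |].
    by have := H (- x); rewrite oppr_gt0 sinN sqrrN -opprD normrN => /(_ x0).
  by rewrite sin0 subrr normr0 expr0n.
pose g := fun t : R => sin t - t.
have dg (t : R) : is_derive t (1 : R) g (cos t - 1).
  exact: (is_deriveB (is_derive_sin t) (is_derive_id t (1 : R))).
have cg : {within `[0, x], continuous g}.
  apply: continuous_subspaceT => t; apply: differentiable_continuous.
  by apply/derivable1_diffP; have [] := dg t.
have [c] := @MVT R g (fun t => cos t - 1) 0 x x0 (fun t _ => dg t) cg.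
rewrite in_itv /= => /andP[c0 cx]; rewrite /g sin0 !subr0 => ->.
rewrite normrM (gtr0_norm x0) expr2 ler_pM2r//.
by rewrite (le_trans (cos_sub1_le_norm c))// gtr0_norm// ltW.
Qed.

(** The real and imaginary parts split into two terms each, and each of the four is at most
    [r ^+ 2 * E]. *)
Lemma cexp_sub1D_le z : cabs (1 + z - cexp z) <= 4 * cabs z ^+ 2 * expR (cabs z).
Proof.
set r := cabs z; set E := expR r.
set x := Re z; set y := Im z.
have xr : `|x| <= r by exact: normRe_le_cabs.
have yr : `|y| <= r by exact: normIm_le_cabs.
have r0 : 0 <= r by exact: cabs_ge0.
have E1 : 1 <= E by rewrite -expR0 ler_expR.
have E0 : 0 < E by exact: expR_gt0.
have xE : expR `|x| <= E by rewrite ler_expR.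
have exE : expR x <= E by rewrite ler_expR (le_trans (ler_norm x)).
have x2 : x ^+ 2 <= r ^+ 2 by rewrite -(real_normK (num_real x)) lerXn2r ?nnegrE.
have y2 : y ^+ 2 <= r ^+ 2 by rewrite -(real_normK (num_real y)) lerXn2r ?nnegrE.
apply: le_trans (cabs_le_ReIm _) _.
have -> : Re (1 + z - cexp z) = - (expR x - 1 - x) - expR x * (cos y - 1).
  by rewrite !ReD ReN /cexp ReM_real /= -/x -/y; ring.
have -> : Im (1 + z - cexp z) = - (sin y - y) - (expR x - 1) * sin y.
  by rewrite !ImD ImN /cexp ImM_real /= -/x -/y; ring.
have h1 : `|expR x - 1 - x| <= r ^+ 2 * E.
  by apply: le_trans (expR_sub1x_le x) _; rewrite ler_pM ?sqr_ge0 ?expR_ge0.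
have h2 : `|expR x * (cos y - 1)| <= r ^+ 2 * E.
  rewrite normrM (ger0_norm (expR_ge0 x)) mulrC ler_pM ?expR_ge0//.
  exact: le_trans (cos_sub1_le y) y2.
have h3 : `|sin y - y| <= r ^+ 2 * E.
  apply: le_trans (sin_sub_le y) _; rewrite -[leLHS]mulr1 ler_pM ?sqr_ge0//.
have h4 : `|(expR x - 1) * sin y| <= r ^+ 2 * E.
  rewrite normrM expr2 mulrAC ler_pM//; last exact: le_trans (normr_sin_le y) yr.
  by apply: le_trans (expR_sub1_le x) _; rewrite ler_pM ?expR_ge0.
have k1 := ler_normB (- (expR x - 1 - x)) (expR x * (cos y - 1)).
have k2 := ler_normB (- (sin y - y)) ((expR x - 1) * sin y).
by rewrite !normrN in k1 k2; lra.
Qed.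

Lemma cabs_1D_le z : cabs (1 + z) <= expR (cabs z).
Proof.
by rewrite (le_trans _ (expR_ge1Dx _))// -cabs1 cabsD.
Qed.

Lemma cabs_prod_1D_le (u : nat -> R[i]) (r : seq nat) :
  cabs (\prod_(j <- r) (1 + u j)) <= expR (\sum_(j <- r) cabs (u j)).
Proof.
elim: r => [|j r IH]; first by rewrite !big_nil cabs1 expR0.
by rewrite !big_cons cabsM expRD ler_pM// cabs_1D_le.
Qed.

(** Factors are replaced by exponentials one at a time, each at a quadratic cost. *)
Lemma prod_1D_sub_cexp (u : nat -> R[i]) (r : seq nat) :
  cabs (\prod_(j <- r) (1 + u j) - cexp (\sum_(j <- r) u j)) <=
  4 * (\sum_(j <- r) cabs (u j) ^+ 2) * expR (\sum_(j <- r) cabs (u j)).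
Proof.
elim: r => [|j r IH]; first by rewrite !big_nil cexp0 subrr cabs0 mulr0 mul0r.
rewrite !big_cons cexpD.
set P := \prod_(j <- r) _ in IH *; set S := \sum_(j <- r) u j in IH *.
set Q := \sum_(j <- r) _ ^+ 2 in IH *; set T := \sum_(j <- r) cabs _ in IH *.
set v := u j.
have -> : (1 + v) * P - cexp v * cexp S =
    (1 + v) * (P - cexp S) + (1 + v - cexp v) * cexp S by ring.
have hS : cabs (cexp S) <= expR T.
  apply: le_trans (cabs_cexp_le _) _; rewrite ler_expR; exact: cabs_sum.
apply: le_trans (cabsD _ _) _; rewrite (cabsM (1 + v)) (cabsM (_ - _)) expRD.
have h1 : cabs (1 + v) * cabs (P - cexp S) <= expR (cabs v) * (4 * Q * expR T).
  by rewrite ler_pM// cabs_1D_le.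
have h2 : cabs (1 + v - cexp v) * cabs (cexp S) <=
    4 * cabs v ^+ 2 * expR (cabs v) * expR T.
  by rewrite ler_pM// cexp_sub1D_le.
by apply: le_trans (lerD h1 h2) _; rewrite le_eqVlt; apply/orP; left; apply/eqP; ring.
Qed.

End ComplexConvergence.

(** * Tails of the exponential series *)

Section ExponentialTail.
Variable R : realType.
Implicit Types (T : R) (K n : nat).
Local Open Scope classical_set_scope.

Definition exp_tail T K : R := expR T - series (exp_coeff T) K.

Lemma series_exp_le T K : 0 <= T -> series (exp_coeff T) K <= expR T.
Proof.
move=> T0; apply: nondecreasing_cvgn_le; last exact: is_cvg_series_exp_coeff.
by apply/nondecreasing_seqP => n; rewrite !seriesEnat /= big_nat_recr//= lerDl exp_coeff_ge0.
Qed.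

Lemma sum_exp_le_tail T K n : 0 <= T -> (K <= n)%N ->
  \sum_(K <= k < n) T ^+ k / k`!%:R <= exp_tail T K.
Proof.
move=> T0 Kn; rewrite /exp_tail lerBrDl; apply: le_trans (series_exp_le n T0).
by rewrite !seriesEnat /= [leRHS](@big_cat_nat _ _ _ K).
Qed.

Lemma cvg_exp_tail T : exp_tail T @ \oo --> (0 : R).
Proof.
rewrite -(subrr (expR T)); apply: cvgB; first exact: cvg_cst.
exact: is_cvg_series_exp_coeff.
Qed.

End ExponentialTail.

(** * Power series dominated by an exponential series *)

Section PowerSeries.
Variable R : realType.
Implicit Types (a c : nat -> R) (w : R[i]) (C : R) (K n : nat).
Local Notation Re := complex.Re.
Local Notation Im := complex.Im.
Local Open Scope classical_set_scope.

Definition psum c w n : R[i] := \sum_(0 <= k < n) (c k)%:C * w ^+ k.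

Definition power_series c w : R[i] :=
  Complex (limn (fun n => Re (psum c w n))) (limn (fun n => Im (psum c w n))).

(** One [C] will serve a whole family of polynomials, which is the domination needed for Tannery's
    theorem. *)
Definition exp_bounded C c := 0 <= C /\ forall k, `|c k| <= C ^+ k / k`!%:R.

Lemma exp_bounded_term C c w k : exp_bounded C c ->
  cabs ((c k)%:C * w ^+ k) <= (C * cabs w) ^+ k / k`!%:R.
Proof.
move=> [C0 h]; rewrite cabsM cabs_real cabsX exprMn mulrAC.
by rewrite ler_wpM2r ?exprn_ge0 ?cabs_ge0.
Qed.

Lemma psum_tail C c w K n : exp_bounded C c -> (K <= n)%N ->
  cabs (psum c w n - psum c w K) <= exp_tail (C * cabs w) K.
Proof.
move=> h Kn; have [C0 _] := h.
rewrite /psum [X in cabs (X - _)](@big_cat_nat _ _ _ K)//= addrAC subrr add0r.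
apply: le_trans (sum_exp_le_tail _ Kn); last by rewrite mulr_ge0 ?cabs_ge0.
by apply: le_trans (cabs_sum _ _ _) _; apply: ler_sum => k _; exact: exp_bounded_term.
Qed.

Lemma ccvg_power_series C c w : exp_bounded C c ->
  ccvg \oo (psum c w) (power_series c w).
Proof.
move=> h; have [C0 _] := h.
have T0 : 0 <= C * cabs w by rewrite mulr_ge0 ?cabs_ge0.
have cvg_part (f : R[i] -> R) : {morph f : x y / x + y} -> f 0 = 0 ->
    (forall z, `|f z| <= cabs z) -> cvgn (fun n => f (psum c w n)).
  move=> fD f0 fle.
  have -> : (fun n => f (psum c w n)) = series (fun k => f ((c k)%:C * w ^+ k)).
    apply/funext => n; rewrite seriesEnat /psum /=; elim: n => [|n IH].
      by rewrite !big_geq.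
    by rewrite !big_nat_recr//= fD IH.
  apply: normed_cvg; apply: (@series_le_cvg _ _ (exp_coeff (C * cabs w))).
  - by move=> k; rewrite normr_ge0.
  - by move=> k; exact: exp_coeff_ge0.
  - by move=> k; apply: le_trans (fle _) _; exact: exp_bounded_term.
  - exact: is_cvg_series_exp_coeff.
split; apply: cvg_part => //.
- exact: ReD.
- exact: normRe_le_cabs.
- exact: ImD.
- exact: normIm_le_cabs.
Qed.

Lemma power_series_tail C c w K : exp_bounded C c ->
  cabs (power_series c w - psum c w K) <= exp_tail (C * cabs w) K.
Proof.
move=> h.
apply: (ccvg_cabs_le (ccvgB (ccvg_power_series w h) (ccvg_cst (F := \oo) (psum c w K)))).
near=> n; apply: psum_tail => //; near: n; exact: nbhs_infty_ge.
Unshelve. all: by end_near. Qed.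

(* Tannery's theorem for power series. *)
Lemma ccvg_power_series_coef (F : set_system nat) (FF : ProperFilter F) C
    (c : nat -> nat -> R) (n : nat -> nat) a w :
  exp_bounded C a -> (\forall N \near F, exp_bounded C (c N)) ->
  (forall N k, (n N <= k)%N -> c N k = 0) ->
  (forall k, c ^~ k @ F --> a k) ->
  ccvg F (fun N => psum (c N) w (n N)) (power_series a w).
Proof.
move=> ha hc hn ca; apply/ccvgP => eps e0.
have e3 : 0 < eps / 3 by rewrite divr_gt0.
have [K hK] : exists K, exp_tail (C * cabs w) K < eps / 3.
  have [K _ h] : \forall K \near \oo, exp_tail (C * cabs w) K < eps / 3.
    by apply: cvgr_lt e3; exact: cvg_exp_tail.
  by exists K; apply: h => /=.
have cK : ccvg F (fun N => psum (c N) w K) (psum a w K).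
  rewrite /psum; elim: (index_iota 0 K) => [|k r IH].
    by rewrite big_nil; under eq_fun do rewrite big_nil; exact: ccvg_cst.
  rewrite big_cons; under eq_fun do rewrite big_cons; apply: ccvgD => //.
  by apply: ccvgM; [exact: ccvg_real|exact: ccvg_cst].
move/ccvgP : cK => /(_ _ e3); apply: filterS2 hc => N hN h.
(* Padding with zero terms makes the sum reach index [K], so that it can be cut there. *)
have -> : psum (c N) w (n N) = psum (c N) w (maxn (n N) K).
  rewrite /psum [RHS](@big_cat_nat _ _ _ (n N)) ?leq_maxl//= [X in _ + X]big_nat_cond.
  rewrite [X in _ + X]big1 ?addr0// => k /andP[/andP[h1 _] _].
  by rewrite hn// mul0r.
have t1 := psum_tail w hN (leq_maxr (n N) K).
have t2 := power_series_tail w K ha.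
set A := psum _ _ (maxn _ _) in t1 *; set B := psum _ _ _ in t1 h.
set D := psum _ _ _ in t2 h.
have -> : A - power_series a w = (A - B) + (B - D) - (power_series a w - D) by ring.
have b1 := cabsB ((A - B) + (B - D)) (power_series a w - D).
have b2 := cabsD (A - B) (B - D).
lra.
Qed.

End PowerSeries.

(** * Polynomials written through the reciprocals of their roots *)

Section RootProducts.
Variable R : realType.
Implicit Types (s : seq R) (w : R[i]).
Local Open Scope classical_set_scope.

(** Reciprocal roots are used so that a root escaping to infinity becomes the harmless entry 0. *)
Definition root_poly s : {poly R} := \prod_(r <- s) (1 - r *: 'X).

Lemma coef_root_poly_cons (r : R) s k : (root_poly (r :: s))`_k =
  (root_poly s)`_k - (if k is k'.+1 then r * (root_poly s)`_k' else 0).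
Proof.
rewrite /root_poly big_cons mulrBl mul1r coefB -scalerAl coefZ coefXM.
by case: k => [|k] //=; rewrite mulr0.
Qed.

Lemma root_poly0 s : (root_poly s)`_0 = 1.
Proof.
elim: s => [|r s IH]; first by rewrite /root_poly big_nil coef1.
by rewrite coef_root_poly_cons IH subr0.
Qed.

Lemma root_poly1 s : (root_poly s)`_1 = - \sum_(r <- s) r.
Proof.
elim: s => [|r s IH]; first by rewrite /root_poly !big_nil coef1 oppr0.
by rewrite coef_root_poly_cons IH root_poly0 mulr1 big_cons opprD addrC.
Qed.

Lemma exprD_ge_bernoulli (x y : R) n : 0 <= x -> 0 <= y ->
  x ^+ n.+1 + n.+1%:R * y * x ^+ n <= (x + y) ^+ n.+1.
Proof.
move=> x0 y0; elim: n => [|n IH]; first by rewrite !expr1 expr0 mulr1 mul1r.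
rewrite [leRHS]exprS; have xy0 : 0 <= x + y by rewrite addr_ge0.
apply: le_trans (ler_wpM2l xy0 IH); rewrite -subr_ge0.
have -> : (x + y) * (x ^+ n.+1 + n.+1%:R * y * x ^+ n) -
    (x ^+ n.+2 + n.+2%:R * y * x ^+ n.+1) = n.+1%:R * y ^+ 2 * x ^+ n.
  by rewrite -[n.+2%:R]natr1 !exprS; ring.
by rewrite !mulr_ge0 ?exprn_ge0.
Qed.

(** Up to sign the coefficients are elementary symmetric functions of nonnegative numbers, bounded
    by [S ^ k] over the factorial of [k], where [S] is their sum. The induction uses the first two
    terms of the binomial expansion of [(S + r) ^ (k + 1)]. *)
Lemma exp_bounded_root_poly s : all (fun r => 0 <= r) s ->
  exp_bounded (\sum_(r <- s) r) (fun k => (root_poly s)`_k).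
Proof.
elim: s => [|r s IH] /=.
  rewrite big_nil; split => // k; rewrite /root_poly big_nil coef1.
  by case: k => [|k]; rewrite ?normr1 ?fact0 ?expr0 ?divr1// normr0 expr0n mul0r.
move=> /andP[r0 /IH[S0 h]]; rewrite big_cons; set S := \sum_(r <- s) r in S0 h *.
split=> [|k]; first by rewrite addr_ge0.
rewrite coef_root_poly_cons; case: k => [|k].
  by rewrite subr0 root_poly0 normr1 expr0 fact0 divr1.
apply: le_trans (ler_normB _ _) _; rewrite normrM (ger0_norm r0).
have h1 := h k.+1; have h2 := ler_wpM2l r0 (h k).
apply: le_trans (lerD h1 h2) _.
have f0 : 0 < (k.+1`!%:R : R) by rewrite ltr0n fact_gt0.
rewrite ler_pdivlMr// mulrDl divfK ?gt_eqF//.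
rewrite (_ : r * _ * _ = k.+1%:R * r * S ^+ k).
  by rewrite [r + S]addrC exprD_ge_bernoulli.
by rewrite factS natrM; field; rewrite pnatr_eq0 -lt0n fact_gt0.
Qed.

Lemma root_poly_eval s w n : (size (root_poly s) <= n)%N ->
  psum (fun k => (root_poly s)`_k) w n = \prod_(r <- s) (1 - r%:C * w).
Proof.
move=> hn.
transitivity (map_poly (real_complex R) (root_poly s)).[w].
  rewrite (@horner_coef_wide _ n); last by rewrite size_map_poly.
  by rewrite /psum big_mkord; apply: eq_bigr => k _; rewrite coef_map.
rewrite /root_poly rmorph_prod /= horner_prod; apply: eq_bigr => r _.
by rewrite rmorphB rmorph1 /= map_polyZ map_polyX !hornerE.
Qed.

Lemma fully_alternates_root_poly (q : {poly R}) : fully_alternates q ->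
  exists s, [/\ all (fun r => 0 <= r) s, sorted >=%R s & q = q`_0 *: root_poly s].
Proof.
move=> [n [e [x [sq hq]]]]; have [rs [s1 s2 s3 s4]] := alternates_roots hq.
pose s := sort >=%R [seq r^-1 | r <- rs].
have rs0 : all (fun r => 0 < r) rs by apply: sub_all s4 => r /andP[].
have Eq : exists c, q = c *: root_poly s.
  exists (lead_coef q * \prod_(r <- rs) (- r)).
  rewrite [LHS](@all_roots_prod_XsubC _ q rs) ?s1 ?uniq_rootsE//.
  rewrite /root_poly (perm_big _ (permEl (perm_sort _ _))) big_map -scalerA.
  congr (_ *: _); rewrite -scaler_prod; apply: eq_big_seq => r rrs.
  have r0 : r != 0 by rewrite gt_eqF//; exact: (allP rs0).
  rewrite scalerBr scalerA mulNr mulfV// scaleN1r opprK addrC.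
  by rewrite -[- r *: 1]mul_polyC mulr1 polyCN.
case: Eq => c Eq; exists s; split.
- rewrite all_sort; apply/allP => _ /mapP[r rrs ->].
  by rewrite invr_ge0 ltW//; exact: (allP rs0).
- by apply: sort_sorted => x' y'; exact: real_leVge (num_real _) (num_real _).
- by rewrite Eq coefZ root_poly0 mulr1.
Qed.

(** The approximants are divided by their constant coefficients, which tend to 1. *)
Lemma approximable_root_poly (a : nat -> R) : a 0 = 1 -> approximable a ->
  exists s : nat -> seq R, [/\ forall N, all (fun r => 0 <= r) (s N),
    forall N, sorted >=%R (s N)
    & forall k, (fun N => (root_poly (s N))`_k) @ \oo --> a k].
Proof.
move=> a0 ha.
have /choice[q hq] : forall N : nat, exists q, fully_alternates q /\
    forall k, (k < N)%N -> `|q`_k - a k| < harmonic N.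
  by move=> N; have [q q1 q2] := ha _ N (harmonic_gt0 N); exists q.
have /choice[s hs] := fun N => fully_alternates_root_poly (hq N).1.
have cq k : (fun N => (q N)`_k) @ \oo --> a k.
  apply/cvgrPdist_lt => eps e0.
  have h : \forall N \near \oo, harmonic N < eps by apply: cvgr_lt e0; exact: cvg_harmonic.
  near=> N; rewrite distrC; apply: lt_trans (_ : harmonic N < eps); last by near: N.
  by apply: (hq N).2; near: N; exact: nbhs_infty_gt.
exists s; split => [N|N|k]; try by have [] := hs N.
have h : (fun N => ((q N)`_0)^-1 * (q N)`_k) @ \oo --> (a 0)^-1 * a k.
  by apply: cvgM => //; apply: cvgV => //; rewrite a0 oner_neq0.
rewrite a0 invr1 mul1r in h; apply: cvg_trans h.
apply: (@near_eq_cvg _ _ \oo eventually_filter); near=> N.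
have q0 : (q N)`_0 != 0.
  rewrite gt_eqF//; near: N; apply: (cvgr_gt _ (cq 0)).
  by rewrite a0.
by have [_ _ E] := hs N; rewrite {2}E coefZ mulKf.
Unshelve. all: by end_near. Qed.

End RootProducts.

(** * Limits of root products *)

Section RootProductLimit.
Variable R : realType.
Implicit Types (s : seq R) (w : R[i]).
Local Open Scope classical_set_scope.

(** The default 0 past the end respects the order because the entries are nonnegative. *)
Lemma sorted_ge_nth s i j : all (fun r => 0 <= r) s -> sorted >=%R s -> (i <= j)%N ->
  nth 0 s j <= nth 0 s i.
Proof.
move=> s0 ss ij; have [js|sj] := ltnP j (size s); last first.
  rewrite [leLHS]nth_default//; have [is_|si] := ltnP i (size s).
    by apply: (allP s0); exact: mem_nth.
  by rewrite nth_default.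
have tr : transitive (>=%R : rel R) by move=> x y z xy yz; exact: le_trans yz xy.
apply: (sorted_leq_nth tr _ 0 ss) => //; first exact: lexx.
by rewrite inE (leq_ltn_trans ij).
Qed.

Lemma nth_ge0 s j : all (fun r => 0 <= r) s -> 0 <= nth 0 s j.
Proof.
move=> s0; have [js|sj] := ltnP j (size s); last by rewrite nth_default.
by apply: (allP s0); exact: mem_nth.
Qed.

Lemma big_nth_wide (T : Type) (idx : T) (op : Monoid.law idx) (f : R -> T) s n :
  f 0 = idx -> (size s <= n)%N ->
  \big[op/idx]_(r <- s) f r = \big[op/idx]_(0 <= j < n) f (nth 0 s j).
Proof.
move=> f0 sn; rewrite (big_nth 0) [RHS](@big_cat_nat _ _ _ (size s))//=.
rewrite [X in op _ X]big_nat_cond [X in op _ X]big1 ?Monoid.mulm1// => j.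
by move=> /andP[/andP[h _] _]; rewrite nth_default.
Qed.

(* The roots beyond the [J]-th largest are replaced by an exponential; monotonicity
   gives [(J + 1) * nth 0 s J <= C]. *)
Lemma root_product_estimate s (C : R) J w :
  all (fun r => 0 <= r) s -> sorted >=%R s -> \sum_(r <- s) r <= C ->
  cabs (\prod_(r <- s) (1 - r%:C * w) - \prod_(0 <= j < J) (1 - (nth 0 s j)%:C * w)
     * cexp (- ((\sum_(r <- s) r - \sum_(0 <= j < J) nth 0 s j)%:C * w)))
  <= expR (C * cabs w) * (4 * (C ^+ 2 * cabs w ^+ 2 * harmonic J) * expR (C * cabs w)).
Proof.
move=> s0 ss sC.
have W0 := cabs_ge0 w; set W := cabs w in W0 *.
have p0 j : 0 <= nth 0 s j by exact: nth_ge0.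
pose n := (J + size s)%N.
have sn : (size s <= n)%N by rewrite leq_addl.
have Jn : (J <= n)%N by rewrite leq_addr.
have Esum : \sum_(r <- s) r = \sum_(0 <= j < J) nth 0 s j + \sum_(J <= j < n) nth 0 s j.
  by rewrite (@big_nth_wide _ _ _ (fun r => r) s n)// (@big_cat_nat _ _ _ J).
have Epr : \prod_(r <- s) (1 - r%:C * w) = \prod_(0 <= j < J) (1 - (nth 0 s j)%:C * w)
    * \prod_(J <= j < n) (1 + - ((nth 0 s j)%:C * w)).
  rewrite (@big_nth_wide _ _ _ (fun r => 1 - r%:C * w) s n)//; last first.
    by rewrite mul0r subr0.
  by rewrite (@big_cat_nat _ _ _ J).
have C0 : 0 <= C.
  by apply: le_trans sC; rewrite Esum addr_ge0// sumr_ge0.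
have head_le : \sum_(0 <= j < J) nth 0 s j <= C.
  by apply: le_trans sC; rewrite Esum lerDl sumr_ge0.
have tail_le : \sum_(J <= j < n) nth 0 s j <= C.
  by apply: le_trans sC; rewrite Esum lerDr sumr_ge0.
have cabs_term j : cabs (- ((nth 0 s j)%:C * w)) = nth 0 s j * W.
  by rewrite cabsN cabsM cabs_real ger0_norm.
rewrite Epr Esum addrAC subrr add0r.
have -> : - ((\sum_(J <= j < n) nth 0 s j)%:C * w) =
    \sum_(J <= j < n) - ((nth 0 s j)%:C * w).
  by rewrite sumrN rmorph_sum mulr_suml.
rewrite -mulrBr cabsM ler_pM ?cabs_ge0//.
  apply: le_trans (cabs_prod_1D_le (fun j => - ((nth 0 s j)%:C * w)) _) _.
  rewrite ler_expR; under eq_bigr do rewrite cabs_term.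
  by rewrite -mulr_suml ler_wpM2r.
apply: le_trans (prod_1D_sub_cexp (fun j => - ((nth 0 s j)%:C * w)) _) _.
under eq_bigr do rewrite cabs_term.
under [X in expR X]eq_bigr do rewrite cabs_term.
have Jnth : nth 0 s J <= C * harmonic J.
  rewrite /harmonic /= ler_pdivlMr ?ltr0n//.
  have : \sum_(0 <= j < J.+1) nth 0 s J <= C.
    have [Js|sJ] := ltnP J (size s).
      apply: le_trans sC; rewrite (@big_nth_wide _ _ _ (fun r => r) s n)//.
      rewrite [leRHS](@big_cat_nat _ _ _ J.+1)//=; last first.
        by rewrite /n -addn1 leq_add2l; case: (size s) Js.
      rewrite -[leLHS]addr0 lerD ?sumr_ge0//; apply: ler_sum_nat => j /andP[_ hj].
      exact: sorted_ge_nth.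
    by rewrite nth_default// big1.
  by rewrite sumr_const_nat subn0 mulr_natr.
rewrite ler_pM ?expR_ge0 ?mulr_ge0 ?sumr_ge0//.
- by move=> j _; rewrite sqr_ge0.
- rewrite ler_wpM2l//.
  have -> : C ^+ 2 * W ^+ 2 * harmonic J = C * (C * harmonic J) * W ^+ 2.
    by ring.
  under eq_bigr do rewrite exprMn.
  rewrite -mulr_suml ler_wpM2r ?sqr_ge0//.
  (* One factor of each square is bounded by the largest entry of the tail. *)
  apply: (@le_trans _ _ (\sum_(J <= j < n) nth 0 s j * (C * harmonic J))).
    apply: ler_sum_nat => j /andP[Jj _]; rewrite expr2 ler_wpM2l//.
    by apply: le_trans Jnth; exact: sorted_ge_nth.
  by rewrite -mulr_suml ler_wpM2r// mulr_ge0// harmonic_ge0.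
- by rewrite ler_expR -mulr_suml ler_wpM2r.
Qed.

(** The image of an ultrafilter is an ultrafilter, and one that contains a compact segment
    converges. *)
Lemma ultra_cvg_bounded (U : set_system nat) (UU : UltraFilter U) (u : nat -> R) (B : R) :
  (\forall N \near U, 0 <= u N <= B) -> exists l : R, u @ U --> l.
Proof.
move=> hu; have UP := @ultra_proper _ _ UU.
have UI : UltraFilter (u @ U).
  split; first exact: fmap_proper_filter.
  move=> G GP UG; apply/seteqP; split=> [A GA|]; last exact: UG.
  have [//|nA] := in_ultra_setVsetC (u @^-1` A) UU.
  exfalso; apply: (@filter_not_empty _ G GP).
  by rewrite -(setICr A); apply: filterI => //; exact: UG.
have := @segment_compact R 0 B; rewrite compact_ultra => /(_ _ UI).
case=> [|l [_ hl]]; last by exists l.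
by apply: filterS hu => N; rewrite /= in_itv.
Qed.

Theorem root_poly_limit (a : nat -> R) : a 0 = 1 -> approximable a ->
  exists (C gamma : R) (l : nat -> R),
  [/\ exp_bounded C a, 0 <= gamma, forall j, 0 <= l j,
      {homo l : i j / (i <= j)%N >-> j <= i}
    & (forall J, \sum_(0 <= j < J) l j <= C) /\
      forall w, ccvg \oo (fun J => \prod_(0 <= j < J) (1 - (l j)%:C * w))
        (power_series a w * cexp (gamma%:C * w))].
Proof.
move=> a0 /(approximable_root_poly a0)[s [s0 ss ca]].
(* Along one ultrafilter the reciprocal roots of every rank converge simultaneously, which replaces
   a diagonal extraction. *)
have [U [UU oU]] := @ultraFilterLemma _ \oo eventually_filter.
have UP := @ultra_proper _ _ UU.
have cU (T : topologicalType) (f : nat -> T) (x : T) : f @ \oo --> x -> f @ U --> x.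
  by move=> h A /h; exact: oU.
have sumE N : \sum_(r <- s N) r = - (root_poly (s N))`_1 by rewrite root_poly1 opprK.
(* The sums of reciprocal roots tend to [- a 1]; the slack 1 makes [C] an eventual bound. *)
pose C := 1 - a 1.
have cS : (fun N => \sum_(r <- s N) r) @ \oo --> - a 1.
  under eq_fun do rewrite sumE; exact: cvgN.
have SC : \forall N \near \oo, \sum_(r <- s N) r <= C.
  by apply: (cvgr_le _ cS); rewrite /C; lra.
have C0 : 0 <= C.
  suff : 0 <= - a 1 by rewrite /C; lra.
  apply: (ler_cvg_to (cvg_cst (0 : R)) cS); apply: nearW => N.
  by rewrite big_seq sumr_ge0// => r /(allP (s0 N)).
have SU : \forall N \near U, \sum_(r <- s N) r <= C by exact: oU.
have nth_le N j : nth 0 (s N) j <= \sum_(r <- s N) r.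
  have [js|sj] := ltnP j (size (s N)); last first.
    by rewrite nth_default// big_seq sumr_ge0// => r /(allP (s0 N)).
  rewrite (big_nth 0) (bigD1_seq j) ?mem_index_iota ?iota_uniq//=.
  by rewrite lerDl sumr_ge0// => i _; exact: nth_ge0.
have /choice[l hl] : forall j, exists l : R, (fun N => nth 0 (s N) j) @ U --> l.
  move=> j; apply: (@ultra_cvg_bounded _ UU _ C).
  by apply: filterS SU => N hN; rewrite nth_ge0//= (le_trans (nth_le N j)).
have hsum J : (fun N => \sum_(0 <= j < J) nth 0 (s N) j) @ U --> \sum_(0 <= j < J) l j.
  by apply: (cvg_big (@add_continuous R)) => j _; exact: hl.
have head_le N J : \sum_(0 <= j < J) nth 0 (s N) j <= \sum_(r <- s N) r.
  rewrite (@big_nth_wide _ _ _ (fun r => r) (s N) (J + size (s N)))// ?leq_addl//.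
  rewrite [leRHS](@big_cat_nat _ _ _ J) ?leq_addr//=.
  by rewrite lerDl sumr_ge0// => j _; exact: nth_ge0.
have l0 j : 0 <= l j.
  apply: (ler_cvg_to (cvg_cst (0 : R)) (hl j)).
  by apply: nearW => N; exact: nth_ge0.
have lmono : {homo l : i j / (i <= j)%N >-> j <= i}.
  move=> i j ij; apply: (ler_cvg_to (hl j) (hl i)).
  by apply: nearW => N; exact: sorted_ge_nth.
have lC J : \sum_(0 <= j < J) l j <= C.
  apply: (ler_cvg_to (hsum J) (cvg_cst C)).
  by apply: filterS SU => N; exact: le_trans.
(* The limiting mass of the reciprocal roots past the [J] largest. The part that remains as [J]
   grows is spread over ever smaller reciprocal roots and becomes the exponent [gamma]. *)
pose g J := - a 1 - \sum_(0 <= j < J) l j.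
have hg J : (fun N => \sum_(r <- s N) r - \sum_(0 <= j < J) nth 0 (s N) j) @ U --> g J.
  by apply: cvgB; [exact: cU|exact: hsum].
have g0 J : 0 <= g J.
  apply: (ler_cvg_to (cvg_cst (0 : R)) (hg J)).
  by apply: nearW => N; rewrite subr_ge0.
have gmono : nonincreasing_seq g.
  apply/nonincreasing_seqP => J.
  by rewrite /g big_nat_recr//= lerD2l lerN2 lerDl.
have gcvg : cvgn g.
  by apply: nonincreasing_is_cvgn => //; exists 0 => _ [J _ <-].
have ha : exp_bounded C a.
  split=> // k; apply: (ler_cvg_to (cvg_norm (ca k)) (cvg_cst (C ^+ k / k`!%:R))).
  apply: filterS SC => N hN; have [S0 h] := exp_bounded_root_poly (s0 N).
  apply: le_trans (h k) _; rewrite ler_wpM2r ?invr_ge0//.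
  by rewrite lerXn2r ?nnegrE.
exists C, (limn g), l; split => //.
  by apply: limr_ge => //; apply: nearW.
split=> // w.
have hP : ccvg U (fun N => \prod_(r <- s N) (1 - r%:C * w)) (power_series a w).
  under eq_fun do rewrite -(root_poly_eval w (leqnn _)).
  apply: (@ccvg_power_series_coef R U UP C) => //.
  - apply: filterS SU => N hN; have [S0 h] := exp_bounded_root_poly (s0 N).
    split=> // k; apply: le_trans (h k) _; rewrite ler_wpM2r ?invr_ge0//.
    by rewrite lerXn2r ?nnegrE.
  - by move=> N k; exact: nth_default.
  - by move=> k; exact: cU.
have hhead J : ccvg U (fun N => \prod_(0 <= j < J) (1 - (nth 0 (s N) j)%:C * w))
    (\prod_(0 <= j < J) (1 - (l j)%:C * w)).
  apply: ccvg_prod => j; apply: ccvgB; first exact: ccvg_cst.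
  by apply: ccvgM; [exact: ccvg_real|exact: ccvg_cst].
(* The bound of [root_product_estimate] is uniform in [N], so it passes to the limit along [U] for
   fixed [J]; [J] tends to infinity afterwards. *)
have hE J : cabs (power_series a w - \prod_(0 <= j < J) (1 - (l j)%:C * w)
      * cexp (- ((g J)%:C * w)))
    <= expR (C * cabs w) * (4 * (C ^+ 2 * cabs w ^+ 2 * harmonic J) * expR (C * cabs w)).
  have h : ccvg U (fun N => \prod_(r <- s N) (1 - r%:C * w)
      - \prod_(0 <= j < J) (1 - (nth 0 (s N) j)%:C * w)
      * cexp (- ((\sum_(r <- s N) r - \sum_(0 <= j < J) nth 0 (s N) j)%:C * w)))
    (power_series a w - \prod_(0 <= j < J) (1 - (l j)%:C * w) * cexp (- ((g J)%:C * w))).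
    apply: ccvgB => //; apply: ccvgM => //; apply: ccvg_cexp; apply: ccvgN.
    by apply: ccvgM; [exact: ccvg_real|exact: ccvg_cst].
  apply: (ccvg_cabs_le h); apply: filterS SU => N hN.
  exact: root_product_estimate.
have h1 : ccvg \oo (fun J => \prod_(0 <= j < J) (1 - (l j)%:C * w) * cexp (- ((g J)%:C * w)))
    (power_series a w).
  apply/ccvgP => eps e0.
  have hB : (fun J => expR (C * cabs w) * (4 * (C ^+ 2 * cabs w ^+ 2 * harmonic J)
      * expR (C * cabs w))) @ \oo --> expR (C * cabs w) * (4 * (C ^+ 2 * cabs w ^+ 2 * 0)
      * expR (C * cabs w)).
    apply: cvgM; first exact: cvg_cst.
    apply: cvgM; last exact: cvg_cst.
    apply: cvgM; first exact: cvg_cst.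
    by apply: cvgM; [exact: cvg_cst|exact: cvg_harmonic].
  rewrite !(mulr0, mul0r) in hB.
  apply: filterS (cvgr_lt _ hB _ e0) => J hJ.
  by rewrite -opprB cabsN (le_lt_trans (hE J)).
have h2 : ccvg \oo (fun J => cexp ((g J)%:C * w)) (cexp ((limn g)%:C * w)).
  by apply: ccvg_cexp; apply: ccvgM; [exact: (ccvg_real gcvg)|exact: ccvg_cst].
have -> : (fun J => \prod_(0 <= j < J) (1 - (l j)%:C * w)) =
    (fun J => \prod_(0 <= j < J) (1 - (l j)%:C * w) * cexp (- ((g J)%:C * w))
      * cexp ((g J)%:C * w)).
  by apply/funext => J; rewrite -mulrA cexpN_mul mulr1.
exact: ccvgM.
Qed.

End RootProductLimit.

(** * Complex differentiability of the power series *)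

Section EntireFunctions.
Variable R : realType.
Implicit Types (a : nat -> R) (z w x h : R[i]) (C : R).
Local Open Scope classical_set_scope.

Lemma derivable_of_quadratic (g : R[i] -> R[i]) z (l : R[i]) (M d : R) : 0 < d ->
  (forall h, cabs h <= d -> cabs (g (z + h) - g z - h * l) <= M * cabs h ^+ 2) ->
  derivable (g : R[i]^o -> R[i]^o) z 1.
Proof.
move=> d0 hg; have M0 : 0 <= M.
  have := hg d%:C; rewrite cabs_real (gtr0_norm d0) => /(_ (lexx d)).
  by move=> /(le_trans (cabs_ge0 _)); rewrite pmulr_lge0// exprn_gt0.
apply/cvg_ex; exists l; apply/cvgrPdist_lt => eps.
rewrite ltcE /= => /andP[/eqP i0 e0].
set e := complex.Re eps in e0; have Ee : eps = e%:C.
  by case: eps i0 @e {e0} => a b /= ->.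
pose r := Num.min d (e / (M + 1)).
have M1 : 0 < M + 1 by rewrite ltr_wpDl.
have r0 : 0 < r by rewrite lt_min d0 divr_gt0.
have r0' : 0 < r%:C :> R[i] by rewrite ltcR.
near=> h.
have h0 : (h : R[i]^o) != 0 by near: h; exact: (@nbhs_dnbhs_neq R[i]^o 0).
have hr : `|h : R[i]^o| < r%:C by near: h; exact: (@dnbhs0_lt _ R[i]^o).
rewrite normr_cabs ltcR in hr.
have hd : cabs h <= d by rewrite (le_trans (ltW hr))// ge_min lexx.
have he : cabs h < e / (M + 1) by rewrite (lt_le_trans hr)// ge_min lexx orbT.
have ch0 : 0 < cabs h.
  by rewrite lt_def cabs_ge0 andbT; apply: contra h0 => /eqP/cabs_eq0 ->.
rewrite [`|_|]normr_cabs Ee ltcR /= /shift /=.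
rewrite /GRing.scale /= mulr1 [h + z]addrC.
have -> : l - h^-1 * (g (z + h) - g z) = - (h^-1 * (g (z + h) - g z - h * l)).
  by field.
rewrite cabsN cabsM cabsV; have := hg _ hd.
rewrite -(ler_pM2l (x := (cabs h)^-1)) ?invr_gt0// => /le_lt_trans; apply.
rewrite mulrCA expr2 mulKf ?gt_eqF//.
rewrite (@le_lt_trans _ _ ((M + 1) * cabs h))// ?ler_wpM2r ?cabs_ge0 ?lerDl//.
by rewrite mulrC -ltr_pdivlMr.
Unshelve. all: by end_near. Qed.

(** In the recursion for the remainder, each of the two terms contributes at most half of the next
    bound, whence the factor 2. For [n = 0] the exponent [n.-1] is harmless, its coefficient being
    0. *)
Lemma expr_second_order x h n : cabs h <= 1 ->
  cabs ((x + h) ^+ n - x ^+ n - n%:R * h * x ^+ n.-1) <=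
  cabs h ^+ 2 * (2 * (cabs x + 1)) ^+ n.
Proof.
move=> h1; set M := cabs x + 1.
have x0 := cabs_ge0 x; have hh0 := cabs_ge0 h.
have M1 : 1 <= M by rewrite lerDr.
have M0 : 0 <= M by apply: le_trans M1.
elim: n => [|n IH].
  by rewrite !expr0 subrr mul0r mul0r subrr cabs0 mulr1 sqr_ge0.
have -> : (x + h) ^+ n.+1 - x ^+ n.+1 - n.+1%:R * h * x ^+ n.+1.-1 =
    (x + h) * ((x + h) ^+ n - x ^+ n - n%:R * h * x ^+ n.-1)
    + n%:R * h ^+ 2 * x ^+ n.-1.
  case: n {IH} => [|n] /=; first by rewrite !expr0; ring.
  by rewrite -[n.+2%:R]natr1 !exprS; ring.
apply: le_trans (cabsD _ _) _; rewrite cabsM.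
have h2 : cabs (x + h) * cabs ((x + h) ^+ n - x ^+ n - n%:R * h * x ^+ n.-1) <=
    M * (cabs h ^+ 2 * (2 * M) ^+ n).
  by rewrite ler_pM ?cabs_ge0// (le_trans (cabsD _ _))// lerD2l.
have h3 : cabs (n%:R * h ^+ 2 * x ^+ n.-1) <= cabs h ^+ 2 * (2 ^+ n * M ^+ n.+1).
  rewrite !cabsM !cabsX mulrAC mulrC ler_wpM2l ?sqr_ge0//.
  have -> : cabs (n%:R : R[i]) = n%:R.
    by rewrite -(rmorph_nat (real_complex R)) cabs_real ger0_norm.
  rewrite ler_pM ?exprn_ge0//.
    by rewrite -natrX ler_nat ltnW// ltn_expl.
  apply: (@le_trans _ _ (M ^+ n.-1)); first by rewrite lerXn2r ?nnegrE// lerDl.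
  by rewrite ler_weXn2l//; case: (n) => // k; rewrite ltnW.
apply: le_trans (lerD h2 h3) _; rewrite le_eqVlt; apply/orP; left; apply/eqP.
by rewrite !exprMn !exprS; ring.
Qed.

Lemma ccvg_shiftS (f : nat -> R[i]) (l : R[i]) : ccvg \oo f l -> ccvg \oo (fun n => f n.+1) l.
Proof. by move=> [h1 h2]; split; [rewrite -cvg_shiftS in h1|rewrite -cvg_shiftS in h2]. Qed.

Lemma power_series_quadratic C a x : exp_bounded C a ->
  exists l E, 0 <= E /\ forall h, cabs h <= 1 ->
    cabs (power_series a (x + h) - power_series a x - h * l) <= E * cabs h ^+ 2.
Proof.
move=> ha; have [C0 hC] := ha.
(* Dividing the coefficients of the derivative by [D] makes them satisfy the bound with the same
   [C]; [D] is positive even if [C = 0]. *)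
pose D := C + 1; have D0 : 0 < D by rewrite ltr_wpDl.
pose c k : R := k.+1%:R * a k.+1 / D.
have hc : exp_bounded C c.
  split=> // k; rewrite /c !normrM normfV (gtr0_norm D0) ler_pdivrMr//.
  rewrite ger0_norm//; apply: le_trans (ler_wpM2l _ (hC k.+1)) _ => //.
  rewrite factS natrM exprS -mulrA.
  have f0 : 0 < (k`!%:R : R) by rewrite ltr0n fact_gt0.
  have -> : k.+1%:R * (C * (C ^+ k / (k.+1%:R * k`!%:R))) = C ^+ k / k`!%:R * C.
    by field; rewrite (gt_eqF f0) nat1r pnatr_eq0.
  by rewrite ler_wpM2l ?divr_ge0 ?exprn_ge0// /D lerDl.
pose M := 2 * (cabs x + 1).
have M0 : 0 <= M by rewrite mulr_ge0 ?addr_ge0 ?cabs_ge0.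
exists (D%:C * power_series c x), (expR (C * M)); split; first exact: expR_ge0.
move=> h h1.
(* Differentiation shifts the index, hence [n.+1] terms against [n]. *)
have hlim : ccvg \oo (fun n => psum a (x + h) n.+1 - psum a x n.+1
    - h * (D%:C * psum c x n))
  (power_series a (x + h) - power_series a x - h * (D%:C * power_series c x)).
  apply: ccvgB.
    by apply: ccvgB; apply: ccvg_shiftS; exact: ccvg_power_series ha.
  by apply: ccvgM; [exact: ccvg_cst|apply: ccvgM; [exact: ccvg_cst|exact: ccvg_power_series hc]].
apply: (ccvg_cabs_le hlim); apply: nearW => n.
have -> : psum a (x + h) n.+1 - psum a x n.+1 - h * (D%:C * psum c x n) =
    \sum_(0 <= k < n.+1) (a k)%:C * ((x + h) ^+ k - x ^+ k - k%:R * h * x ^+ k.-1).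
  under [RHS]eq_bigr do rewrite !mulrBr.
  rewrite !sumrB -/(psum a (x + h) n.+1) -/(psum a x n.+1); congr (_ - _).
  rewrite [RHS]big_nat_recl//= !mul0r mulr0 add0r /psum !mulr_sumr.
  apply: eq_bigr => k _; rewrite /c.
  have -> : (k.+1%:R : R[i]) = (k.+1%:R)%:C by rewrite rmorph_nat.
  rewrite !rmorphM fmorphV /=; field.
  by rewrite fmorph_eq0 gt_eqF.
apply: le_trans (cabs_sum _ _ _) _.
apply: (@le_trans _ _ (\sum_(0 <= k < n.+1) cabs h ^+ 2 * exp_coeff (C * M) k)).
  apply: ler_sum => k _; rewrite cabsM cabs_real /exp_coeff /= exprMn.
  have -> : cabs h ^+ 2 * (C ^+ k * M ^+ k / k`!%:R) =
    (C ^+ k / k`!%:R) * (cabs h ^+ 2 * M ^+ k) by ring.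
  by rewrite ler_pM ?cabs_ge0//; exact: expr_second_order.
rewrite -mulr_sumr mulrC ler_wpM2r ?sqr_ge0//.
by have := series_exp_le n.+1 (mulr_ge0 C0 M0); rewrite seriesEnat.
Qed.

Lemma entire_power_series_sq C a : exp_bounded C a ->
  entire (fun z => power_series a (z ^+ 2 / 4)).
Proof.
move=> ha z; have [l [E [E0 hE]]] := power_series_quadratic (z ^+ 2 / 4) ha.
pose W := cabs z + 1; have z0 := cabs_ge0 z.
have W1 : 1 <= W by rewrite lerDr.
have W0 : 0 < W by apply: lt_le_trans W1.
have c4 : cabs (4 : R[i]) = 4.
  by rewrite -(rmorph_nat (real_complex R)) cabs_real ger0_norm.
(* The remainder consists of that of [hE] at the increment [k] of [z ^+ 2 / 4], where
   [cabs k <= W * cabs h], and of [h ^+ 2 / 4 * l]. The radius [W^-1] keeps [cabs k] at most 1. *)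
apply: (@derivable_of_quadratic _ z (z / 2 * l) (E * W ^+ 2 + cabs l) W^-1).
  by rewrite invr_gt0.
move=> h hW; have h0 := cabs_ge0 h.
have h1 : cabs h <= 1 by apply: le_trans hW _; rewrite invf_le1.
pose k := z * h / 2 + h ^+ 2 / 4.
have Ek : (z + h) ^+ 2 / 4 = z ^+ 2 / 4 + k by rewrite /k; field.
have hk : cabs k <= W * cabs h.
  have -> : k = (z * 2 + h) * h / 4 by rewrite /k; field.
  rewrite !cabsM cabsV c4.
  have : cabs (z * 2 + h) <= cabs z * 2 + cabs h.
    apply: le_trans (cabsD _ _) _; rewrite cabsM.
    by rewrite -(rmorph_nat (real_complex R)) cabs_real ger0_norm.
  move=> hz; rewrite mulrAC ler_wpM2r// /W; lra.
have hk1 : cabs k <= 1.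
  by apply: le_trans hk _; rewrite mulrC -ler_pdivlMr// mul1r.
rewrite Ek.
have -> : power_series a (z ^+ 2 / 4 + k) - power_series a (z ^+ 2 / 4) - h * (z / 2 * l) =
  (power_series a (z ^+ 2 / 4 + k) - power_series a (z ^+ 2 / 4) - k * l)
  + h ^+ 2 / 4 * l by rewrite /k; field.
apply: le_trans (cabsD _ _) _; rewrite [leRHS]mulrDl; apply: lerD.
  apply: le_trans (hE _ hk1) _; rewrite -mulrA ler_wpM2l// -exprMn.
  by apply: lerXn2r => //; rewrite nnegrE ?cabs_ge0// mulr_ge0// ltW.
rewrite (cabsM (_ / 4)) (cabsM (h ^+ 2)) cabsX cabsV c4 mulrC ler_wpM2l ?cabs_ge0//.
by have := sqr_ge0 (cabs h); lra.
Qed.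

Lemma real_power_series a (t : R) : complex.Im (power_series a t%:C) = 0.
Proof.
rewrite /power_series /=; have -> : (fun n => complex.Im (psum a t%:C n)) = fun=> 0.
  apply/funext => n; rewrite /psum.
  have -> : \sum_(0 <= k < n) (a k)%:C * t%:C ^+ k = (\sum_(0 <= k < n) a k * t ^+ k)%:C.
    by rewrite rmorph_sum; apply: eq_bigr => k _; rewrite rmorphM rmorphXn.
  by [].
by rewrite lim_cst.
Qed.

End EntireFunctions.

(** * Zeros of the infinite product *)

Section ProductRepresentation.
Variable R : realType.
Implicit Types (z w : R[i]) (l : nat -> R) (C : R).
Local Open Scope classical_set_scope.

(** Weierstrass's product inequality, with content only when the left side is positive. *)
Lemma cabs_prod_1D_ge (u : nat -> R[i]) (r : seq nat) :
  1 - \sum_(j <- r) cabs (u j) <= cabs (\prod_(j <- r) (1 + u j)).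
Proof.
elim: r => [|j r IH]; first by rewrite !big_nil subr0 cabs1.
rewrite !big_cons cabsM.
set S := \sum_(j <- r) _ in IH *; set P := cabs (\prod_(j <- r) _) in IH *.
have P0 : 0 <= P by exact: cabs_ge0.
have S0 : 0 <= S by apply: sumr_ge0 => i _; exact: cabs_ge0.
have v0 := cabs_ge0 (u j); have v1 := cabs_ge0 (1 + u j).
have hv : 1 - cabs (u j) <= cabs (1 + u j).
  rewrite lerBlDr -cabs1; have {1}-> : (1 : R[i]) = (1 + u j) - u j by rewrite addrK.
  exact: cabsB.
have [h|h] := leP (1 - (cabs (u j) + S)) 0; first by apply: le_trans h _; rewrite mulr_ge0.
apply: (@le_trans _ _ ((1 - cabs (u j)) * (1 - S))); last by rewrite ler_pM//; lra.
by rewrite mulrBl mul1r mulrBr mulr1; have := mulr_ge0 v0 S0; lra.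
Qed.

(** Past some [J0] the sum of the [l j * cabs w] is at most 1/2, so the partial products keep at
    least half the modulus of the nonzero product of the first [J0] factors. *)
Lemma infinite_product_neq0 l C w (p : R[i]) : (forall j, 0 <= l j) ->
  (forall J, \sum_(0 <= j < J) l j <= C) ->
  ccvg \oo (fun J => \prod_(0 <= j < J) (1 - (l j)%:C * w)) p ->
  (forall j, 1 - (l j)%:C * w != 0) -> p != 0.
Proof.
move=> l0 lC hp hw.
pose S J := \sum_(0 <= j < J) l j.
have Smono : nondecreasing_seq S.
  by apply/nondecreasing_seqP => J; rewrite /S big_nat_recr//= lerDl.
have Scvg : cvgn S by apply: nondecreasing_is_cvgn => //; exists C => _ [J _ <-]; exact: lC.
have W0 : 0 < 2 * cabs w + 1 by rewrite ltr_wpDl// mulr_ge0 ?cabs_ge0.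
have [J0 hJ0] : exists J0, limn S - (2 * cabs w + 1)^-1 < S J0.
  have : \forall J \near \oo, limn S - (2 * cabs w + 1)^-1 < S J.
    by apply: (cvgr_gt _ Scvg); rewrite gtrBl invr_gt0.
  by case=> J _ h; exists J; apply: h => /=.
pose h0 := cabs (\prod_(0 <= j < J0) (1 - (l j)%:C * w)).
have h0gt : 0 < h0.
  rewrite lt_def cabs_ge0 andbT; apply/negP => /eqP/cabs_eq0/eqP.
  by rewrite prodf_seq_eq0 => /hasP[j _] /=; rewrite (negbTE (hw j)).
suff : h0 / 2 <= cabs p.
  by move=> hle; apply/eqP => p0; move: hle; rewrite p0 cabs0; lra.
have hc : (fun J => cabs (\prod_(0 <= j < J) (1 - (l j)%:C * w))) @ \oo --> cabs p.
  exact: ccvg_cabs_cvg.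
apply: (ler_cvg_to (cvg_cst (h0 / 2)) hc); near=> J.
have JJ : (J0 <= J)%N by near: J; exact: nbhs_infty_ge.
rewrite (@big_cat_nat _ _ _ J0)//= cabsM -/h0 ler_wpM2l ?cabs_ge0//.
have := cabs_prod_1D_ge (fun j => - ((l j)%:C * w)) (index_iota J0 J).
apply: le_trans.
under eq_bigr do rewrite cabsN cabsM cabs_real (ger0_norm (l0 _)).
rewrite -mulr_suml.
have hS : \sum_(J0 <= j < J) l j <= (2 * cabs w + 1)^-1.
  have : S J <= limn S by exact: nondecreasing_cvgn_le.
  rewrite {1}/S (@big_cat_nat _ _ _ J0)//= -/(S J0); lra.
have := ler_wpM2r (cabs_ge0 w) hS.
have : (2 * cabs w + 1)^-1 * cabs w <= 2^-1.
  by rewrite mulrC ler_pdivrMr//; have := cabs_ge0 w; lra.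
lra.
Unshelve. all: by end_near. Qed.

End ProductRepresentation.

(** * Membership in the Laguerre-Polya class *)

Section LaguerrePolya.
Variable R : realType.
Implicit Types (z w : R[i]) (l : nat -> R) (C gamma : R).
Local Open Scope classical_set_scope.

Lemma ccvg_half (u : nat -> R[i]) (x : R[i]) : ccvg \oo u x -> ccvg \oo (fun n => u n./2) x.
Proof.
have h : (half : nat -> nat) @ \oo --> \oo.
  move=> A [N _ hN]; exists N.*2 => // n /= hn; apply: hN => /=.
  by rewrite -(doubleK N) half_leq.
by move=> [h1 h2]; split; [apply: (cvg_comp _ _ h h1)|apply: (cvg_comp _ _ h h2)].
Qed.

(* [signed_root l i] is the inverse of the [i]-th root of the product in [z]; it is
   [0] when there is no such root. *)
Definition signed_root l (i : nat) : R := (-1) ^+ i * (Num.sqrt (l i./2) / 2).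

(** This is [lp_factor] in terms of the inverse of the root, so that [t = 0] gives the factor 1. *)
Definition primary_factor (t : R) z : R[i] := (1 - z * t%:C) * cexp (z * t%:C).

Lemma primary_factor0 z : primary_factor 0 z = 1.
Proof. by rewrite /primary_factor mulr0 subr0 mul1r cexp0. Qed.

Lemma primary_factor_pair (t : R) z :
  primary_factor t z * primary_factor (- t) z = 1 - (t ^+ 2)%:C * z ^+ 2.
Proof.
rewrite /primary_factor rmorphN mulrN opprK mulrACA -cexpD subrr cexp0 mulr1.
by rewrite rmorphXn; ring.
Qed.

(** Indices [2 j] and [2 j + 1] carry opposite roots, whose exponentials cancel; an odd [n] leaves
    one factor unpaired. *)
Lemma prod_primary_factors l z n : (forall j, 0 <= l j) ->
  \prod_(0 <= i < n) primary_factor (signed_root l i) z =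
  \prod_(0 <= j < n./2) (1 - (l j)%:C * (z ^+ 2 / 4))
  * (if odd n then primary_factor (Num.sqrt (l n./2) / 2) z else 1).
Proof.
move=> l0; rewrite -{1}(odd_double_half n).
have E m : \prod_(0 <= i < m.*2) primary_factor (signed_root l i) z =
    \prod_(0 <= j < m) (1 - (l j)%:C * (z ^+ 2 / 4)).
  elim: m => [|m IH]; first by rewrite !big_geq.
  rewrite doubleS !big_nat_recr//= IH -mulrA; congr (_ * _).
  have -> : signed_root l m.*2.+1 = - signed_root l m.*2.
    by rewrite /signed_root /= uphalf_double doubleK exprS mulN1r mulNr.
  rewrite /signed_root doubleK -mul2n exprM sqrrN !expr1n.
  rewrite mul1r primary_factor_pair.
  rewrite expr_div_n sqr_sqrtr// rmorphM fmorphV rmorphXn rmorph_nat /= expr2.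
  by congr (1 - _); field.
case: (odd n); last by rewrite add0n E mulr1.
rewrite [nat_of_bool true]/= add1n big_nat_recr//= E; congr (_ * _).
congr (primary_factor _ z); rewrite /signed_root doubleK -mul2n exprM sqrrN.
by rewrite !expr1n mul1r.
Qed.

Lemma cvg_roots0 l C : (forall j, 0 <= l j) -> {homo l : i j / (i <= j)%N >-> j <= i} ->
  (forall J, \sum_(0 <= j < J) l j <= C) -> l @ \oo --> (0 : R).
Proof.
move=> l0 lm lC.
have hC : (fun J => C * harmonic J) @ \oo --> (C * 0 : R).
  by apply: cvgM; [exact: cvg_cst|exact: cvg_harmonic].
rewrite mulr0 in hC; apply: (squeeze_cvgr _ (cvg_cst (0 : R)) hC).
apply: nearW => J; rewrite l0 /= /harmonic /= ler_pdivlMr ?ltr0n//.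
apply: le_trans (lC J.+1).
have -> : l J * J.+1%:R = \sum_(0 <= j < J.+1) l J.
  by rewrite sumr_const_nat subn0 mulr_natr.
by apply: ler_sum_nat => j /andP[_ jJ]; exact: lm.
Qed.

(** The unpaired factor tends to 1, because a monotone summable sequence tends to 0. *)
Lemma ccvg_primary_factors l C z (p : R[i]) : (forall j, 0 <= l j) ->
  {homo l : i j / (i <= j)%N >-> j <= i} -> (forall J, \sum_(0 <= j < J) l j <= C) ->
  ccvg \oo (fun J => \prod_(0 <= j < J) (1 - (l j)%:C * (z ^+ 2 / 4))) p ->
  ccvg \oo (fun n => \prod_(0 <= i < n) primary_factor (signed_root l i) z) p.
Proof.
move=> l0 lm lC hp; under eq_fun do rewrite prod_primary_factors//.
rewrite -[p]mulr1; apply: ccvgM; first exact: (ccvg_half hp).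
have h1 : ccvg \oo (fun j => primary_factor (Num.sqrt (l j) / 2) z) 1.
  rewrite -[X in ccvg _ _ X](primary_factor0 z).
  have hz : ccvg \oo (fun j => z * (Num.sqrt (l j) / 2)%:C) (z * 0%:C).
    apply: ccvgM; first exact: ccvg_cst.
    apply: ccvg_real; rewrite -(mul0r (2^-1)); apply: cvgM; last exact: cvg_cst.
    rewrite -(sqrtr0 R); apply: (cvg_comp l Num.sqrt (cvg_roots0 l0 lm lC)).
    exact: sqrt_continuous.
  apply: ccvgM; last exact: ccvg_cexp.
  by apply: ccvgB; [exact: ccvg_cst|].
have /ccvgP h2 := ccvg_half h1; apply/ccvgP => eps e0.
apply: filterS (h2 _ e0) => n; case: (odd n) => // _.
by rewrite subrr cabs0.
Qed.

(** By monotonicity the positive entries form an initial segment; each gives two roots, whence the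
    doubling in the finite case. *)
Lemma support_below l : (forall j, 0 <= l j) ->
  {homo l : i j / (i <= j)%N >-> j <= i} ->
  exists omega, forall i, below omega i = (0 < l i./2).
Proof.
move=> l0 lm; have [h|h] := pselect (exists j, l j == 0).
  exists (Some (ex_minn h).*2) => i /=; case: ex_minnP => j /eqP lj hmin.
  rewrite -ltn_half_double lt_def l0 andbT; apply/idP/idP => [ij|].
    by apply/negP => /hmin; rewrite leqNgt ij.
  apply: contraNT; rewrite -leqNgt => ji.
  by rewrite eq_le l0 andbT -lj lm.
exists None => i /=; rewrite lt_def l0 andbT; apply/esym/negP => hi.
by apply: h; exists i./2.
Qed.

Lemma lp_representable_of_product (g : R[i] -> R[i]) C gamma l : 0 <= gamma ->
  (forall j, 0 <= l j) -> {homo l : i j / (i <= j)%N >-> j <= i} ->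
  (forall J, \sum_(0 <= j < J) l j <= C) ->
  (forall z, ccvg \oo (fun J => \prod_(0 <= j < J) (1 - (l j)%:C * (z ^+ 2 / 4)))
    (g z * cexp (gamma%:C * (z ^+ 2 / 4)))) -> lp_representable g.
Proof.
move=> g0 l0 lm lC hg; have [omega homega] := support_below l0 lm.
have root_neq0 i : below omega i -> signed_root l i != 0.
  rewrite homega => li; rewrite mulf_neq0 ?mulf_neq0 ?invr_neq0//.
    by rewrite expf_neq0// oppr_eq0 oner_eq0.
  by rewrite gt_eqF// sqrtr_gt0.
(* Opposite roots leave no linear exponent, so [beta = 0]. Where [l] vanishes the inverse is the
   default value 0, at an index that [below] excludes. *)
exists 1, (gamma / 4), 0, 0%N, omega, (fun i => (signed_root l i)^-1); split.
- by rewrite divr_ge0.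
- by move=> i hi; rewrite invr_neq0// root_neq0.
- have E i : below omega i -> ((signed_root l i)^-1 ^- 2)%R = l i./2 / 4.
    move=> hi; rewrite exprVn invrK /signed_root exprMn -exprM mulnC exprM sqrrN.
    by rewrite !expr1n mul1r expr_div_n sqr_sqrtr// -natrX.
  (* Each [l j] occurs at two indices with weight 1/4. *)
  apply: (@le_lt_trans _ _ (C / 2)%:E); last exact: ltry.
  apply: lime_le; first by apply: is_cvg_nneseries => i _ hi; rewrite lee_fin E// divr_ge0.
  apply: nearW => n.
  rewrite (eq_bigr (fun i => (l i./2 / 4)%:E)); last by move=> i hi; rewrite E.
  rewrite sumEFin lee_fin.
  apply: (@le_trans _ _ (\sum_(0 <= i < n.*2) l i./2 / 4)).
    rewrite [leRHS](@big_cat_nat _ _ _ n) -?addnn ?leq_addr//=.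
    rewrite big_mkcond -[leLHS]addr0 lerD//; last first.
      by apply: sumr_ge0 => i _; rewrite divr_ge0.
    by apply: ler_sum => i _; case: ifP => // _; rewrite divr_ge0.
  have -> : \sum_(0 <= i < n.*2) l i./2 / 4 = (\sum_(0 <= j < n) l j) / 2.
    elim: (n) => [|k IH]; first by rewrite !big_geq// mul0r.
    rewrite doubleS !big_nat_recr//= IH uphalf_double doubleK mulrDl -addrA.
    by congr (_ + _); field.
  by rewrite ler_wpM2r.
- move=> z; exists (g z * cexp (gamma%:C * (z ^+ 2 / 4))).
    apply/ccvg_cvg.
    have -> : lp_product omega (fun i => (signed_root l i)^-1) z =
        (fun n => \prod_(0 <= i < n) primary_factor (signed_root l i) z).
      apply/funext => n; rewrite /lp_product big_mkcond; apply: eq_bigr => i _.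
      rewrite homega; case: ltP => [hi|hi].
        by rewrite /lp_factor /primary_factor fmorphV invrK.
      have li0 : l i./2 = 0 by apply/eqP; rewrite eq_le hi l0.
      by rewrite /signed_root li0 sqrtr0 mul0r mulr0 primary_factor0.
    exact: ccvg_primary_factors l0 lm lC (hg z).
  rewrite expr0 mul1r mul1r mul0r addr0 mulrCA -cexpD.
  have -> : - (gamma / 4)%:C * z ^+ 2 + gamma%:C * (z ^+ 2 / 4) = 0.
    by rewrite rmorphM fmorphV rmorph_nat; field.
  by rewrite cexp0 mulr1.
Qed.

Lemma real_of_sqr_pos z (t : R) : 0 < t -> z ^+ 2 = t%:C -> complex.Im z = 0.
Proof.
case: z => x y /= t0; rewrite expr2 => /eqP; rewrite eq_complex /= => /andP[/eqP h1 /eqP h2].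
have [//|y0] := eqVneq y 0.
have : x * y = 0 by move: h2; rewrite [y * x]mulrC; lra.
move=> /eqP; rewrite mulf_eq0 (negbTE y0) orbF => /eqP x0.
by move: h1 t0; rewrite x0 mul0r sub0r -expr2; have := sqr_ge0 y; lra.
Qed.

Lemma laguerre_polya_approximable (a : nat -> R) : a 0%N = 1 -> approximable a ->
  laguerre_polya (fun z => power_series a (z ^+ 2 / 4)).
Proof.
move=> a0 ha; have [C [gamma [l [hC g0 l0 lm [lC hl]]]]] := root_poly_limit a0 ha.
split.
- split; first exact: entire_power_series_sq hC.
  move=> x; have -> : (x%:C ^+ 2 / 4 : R[i]) = (x ^+ 2 / 4)%:C.
    by rewrite rmorphM fmorphV rmorphXn rmorph_nat.
  exact: real_power_series.
- move=> z gz; have hz := hl (z ^+ 2 / 4); rewrite gz mul0r in hz.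
  (* At a zero of the function the infinite product vanishes, so one of its factors does, and
     [z ^+ 2] is the positive number [4 / l j]. *)
  have [j hj] : exists j, 1 - (l j)%:C * (z ^+ 2 / 4) = 0.
    apply: contrapT => h.
    have /eqP : (0 : R[i]) != 0.
      apply: (infinite_product_neq0 l0 lC hz) => j.
      by apply/eqP => hj; apply: h; exists j.
    by [].
  have lj0 : l j != 0.
    by apply/eqP => lj; move/eqP: hj; rewrite lj mul0r subr0 oner_eq0.
  apply: (@real_of_sqr_pos z (4 / l j)); first by rewrite divr_gt0// lt_def lj0 l0.
  have ljC : (l j)%:C != 0 :> R[i] by rewrite fmorph_eq0.
  move/eqP: hj; rewrite subr_eq0 => /eqP hj.
  rewrite rmorphM fmorphV rmorph_nat /=.
  apply: (mulfI ljC); rewrite [RHS]mulrCA mulfV// mulr1.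
  by apply: (@mulIf _ 4^-1); rewrite ?invr_neq0// -mulrA -hj mulfV.
- exact: (lp_representable_of_product g0 l0 lm lC (fun z => hl (z ^+ 2 / 4))).
Qed.

(** The sign of the argument is moved into the coefficients, which are real. *)
Lemma hyp1F2_power_series (m : nat) (b c C : R) z :
  exp_bounded C (hyp1F2_term (1 / 2 + m%:R) b c (-1)) ->
  hyp1F2 (1 / 2 + m%:R) b%:C c%:C (- (z ^+ 2 / 4)) =
  power_series (hyp1F2_term (1 / 2 + m%:R) b c (-1)) (z ^+ 2 / 4).
Proof.
move=> h; have pC (x : R) k : pochhammer x%:C k = (pochhammer x k)%:C.
  rewrite /pochhammer rmorph_prod; apply: eq_bigr => i _.
  by rewrite rmorphD rmorph_nat.
have E k : hyp1F2_term (1 / 2 + m%:R) b%:C c%:C (- (z ^+ 2 / 4)) k =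
    (hyp1F2_term (1 / 2 + m%:R) b c (-1) k)%:C * (z ^+ 2 / 4) ^+ k.
  have -> : (1 / 2 + m%:R : R[i]) = (1 / 2 + m%:R)%:C.
    by rewrite rmorphD rmorphM fmorphV rmorph1 !rmorph_nat.
  rewrite /hyp1F2_term !pC -[- (z ^+ 2 / 4)]mulN1r exprMn mulrA; congr (_ * _).
  by rewrite !rmorphM fmorphV !rmorphM rmorphXn rmorphN1 rmorph_nat.
apply: ccvg_lim; have := ccvg_power_series (z ^+ 2 / 4) h.
congr ccvg; apply/funext => n; rewrite /psum seriesEnat.
by apply: eq_bigr => k _; rewrite E.
Qed.

End LaguerrePolya.

Theorem theorem7p3 (R : realType) (m k : nat) (b c : R)
    (hk : (1 <= k <= 2 * m + 2)%N) (hb : 0 < b) (hc : 0 < c)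
    (hbc : b + c = k%:R) :
  laguerre_polya
    (fun z : R[i] => hyp1F2 (1 / 2 + m%:R) b%:C c%:C (- (z ^+ 2 / 4))).
Proof.
have ha := approximable_1F2 hk hb hc hbc.
have a0 : hyp1F2_term (1 / 2 + m%:R) b c (-1) 0 = 1.
  by rewrite /hyp1F2_term !pochhammer0 fact0 expr0 !mulr1 divr1.
(* The coefficient bound [hC] ensures convergence, which identifies the limit defining [hyp1F2] with
   [power_series]. *)
have [C [_ [_ [hC _ _ _ _]]]] := root_poly_limit a0 ha.
have -> : (fun z : R[i] => hyp1F2 (1 / 2 + m%:R) b%:C c%:C (- (z ^+ 2 / 4))) =
    (fun z => power_series (hyp1F2_term (1 / 2 + m%:R) b c (-1)) (z ^+ 2 / 4)).
  by apply/funext => z; exact: hyp1F2_power_series hC.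
exact: laguerre_polya_approximable.
Qed.
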